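(* Let $n\geq 3$ be an integer and let $\mathcal{NF}_n\subset\mathbb{P}^2_{\mathbb{C}}$ be the arrangement of $3n-1$ lines defined by $$\widetilde{Q}(x,y,z)=\frac{(x^{n}-y^{n})(y^{n}-z^{n})(z^{n}-x^{n})}{x-y}=(x^{n-1}+yx^{n-2}+\dots+y^{n-2}x+y^{n-1})(y^{n}-z^{n})(z^{n}-x^{n})=0.$$ Then $\mathcal{NF}_n$ is nearly free with exponents $d_1=n+1$ and $d_2=2n-2$.
   Context: Let $S=\mathbb{C}[x,y,z]$ with its standard grading and let $\mathfrak{m}=\langle x,y,z\rangle$. For a reduced plane curve $C\subset\mathbb{P}^2_{\mathbb{C}}$ of degree $d$ given by $f=0$, with $f\in S$ homogeneous, let $J_f=\langle \partial_x f,\partial_y f,\partial_z f\rangle$ be the Jacobian ideal, $I_f$ the saturation of $J_f$ with respect to $\mathfrak{m}$, $N(f)=I_f/J_f$ (a graded $S$-module), and $M(f)=S/J_f$ the Milnor algebra. The curve $C$ is called nearly free if $N(f)\neq 0$ and $\dim_{\mathbb{C}} N(f)_k\leq 1$ for every $k$. If $C$ is nearly free, the minimal graded free resolution of $M(f)$ has the form $$0\to S(-b-2(d-1))\to S(-d_1-(d-1))\oplus S(-d_2-(d-1))\oplus S(-d_3-(d-1))\to S^3(-d+1)\to S$$ for integers $d_1\le d_2\le d_3$ and $b$ with $d_1+d_2=d$, $d_2=d_3$ and $b=d_2-d+2$. The pair $(d_1,d_2)$ is called the exponents of the nearly free curve $C$. A line arrangement is identified with the reduced curve that is the union of its lines.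 *)

(* Defs.v *)
From mathcomp Require Export all_boot all_order all_algebra.
From mathcomp Require Export complex reals mpoly.

Set Implicit Arguments.
Unset Strict Implicit.
Unset Printing Implicit Defensive.

Import GRing.Theory Num.Theory.
Local Open Scope ring_scope.

(* Ideals of a commutative ring, as predicates *)

Definition ideal_span (S : comNzRingType) (G : S -> Prop) (p : S) : Prop :=
  exists (r : nat) (c g : 'I_r -> S),
    (forall i, G (g i)) /\ p = \sum_i c i * g i.

Definition ideal_pow (S : comNzRingType) (I : S -> Prop) (k : nat) : S -> Prop :=
  ideal_span (fun q =>
    exists h : 'I_k -> S, (forall i, I (h i)) /\ q = \prod_i h i).

(* J : m^infinity, the union over k of the colon ideals J : m^k *)
Definition saturation (S : comNzRingType) (m J : S -> Prop) (p : S) : Prop :=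
  exists k, forall q, ideal_pow m k q -> J (q * p).

Section PlaneCurves.

Variable K : fieldType.
Local Notation S := {mpoly K[3]}.

(* The ring structure on 'I_3 gives the indices 0, 1, 2 their meaning. *)
Definition varx : S := 'X_(0 : 'I_3).
Definition vary : S := 'X_(1 : 'I_3).
Definition varz : S := 'X_(2 : 'I_3).

Definition irrelevant_ideal : S -> Prop :=
  ideal_span (fun q => exists i : 'I_3, q = 'X_i).

Definition jacobian_ideal (f : S) : S -> Prop :=
  ideal_span (fun q => exists i : 'I_3, q = f^`M(i)).

Definition saturated_jacobian_ideal (f : S) : S -> Prop :=
  saturation irrelevant_ideal (jacobian_ideal f).

Definition reduced_plane_curve (d : nat) (f : S) : Prop :=
  [/\ (0 < d)%N, f != 0, f \is d.-homog &
      forall (g : S) (k : nat),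
        (exists h, g ^+ k = h * f) -> exists h, g = h * f].

(* The reduced curve f = 0 is the union of m pairwise distinct lines. *)
Definition line_arrangement (m : nat) (f : S) : Prop :=
  exists l : 'I_m -> S,
    [/\ forall i, l i \is 1.-homog,
        forall i, l i != 0,
        forall i j, i != j -> ~ (exists c : K, l i = c *: l j) &
        f = \prod_i l i].

Definition graded_part (I : S -> Prop) (k : nat) (p : S) : Prop :=
  I p /\ p \is k.-homog.

(* For K-subspaces B of A: the quotient A / B has a basis of r classes. *)
Definition quotient_dim (A B : S -> Prop) (r : nat) : Prop :=
  exists e : 'I_r -> S,
    [/\ forall i, A (e i),
        forall c : 'I_r -> K, B (\sum_i c i *: e i) -> forall i, c i = 0 &
        forall p, A p -> exists c : 'I_r -> K, B (p - \sum_i c i *: e i)].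

(* As J_f is homogeneous, N(f)_k is the quotient of (I_f)_k by (J_f)_k. *)
Definition nearly_free (d : nat) (f : S) : Prop :=
  [/\ reduced_plane_curve d f,
      exists p, saturated_jacobian_ideal f p /\ ~ jacobian_ideal f p &
      forall k, exists2 r, (r <= 1)%N &
        quotient_dim (graded_part (saturated_jacobian_ideal f) k)
                     (graded_part (jacobian_ideal f) k) r].

Definition homog_int (e : int) (p : S) : Prop :=
  if e is Posz k then p \is k.-homog else p = 0.

(* A list s of integers stands for the graded free module with summands
   S(-a), a in s.  Elements are row vectors and a matrix acts by right
   multiplication; entry (i, j) of a homomorphism of degree 0 has degree
   s`_i - t`_j. *)
Definition graded_hom (s t : seq int) (A : 'M[S]_(size s, size t)) : Prop :=
  forall (i : 'I_(size s)) (j : 'I_(size t)), homog_int (s`_i - t`_j) (A i j).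

(* The image lies in m times the target. *)
Definition minimal_mx (m n : nat) (A : 'M[S]_(m, n)) : Prop :=
  forall i j, irrelevant_ideal (A i j).

Definition exact_mx (m n p : nat) (A : 'M[S]_(m, n)) (B : 'M[S]_(n, p)) : Prop :=
  forall v : 'rV[S]_n, v *m B = 0 <-> exists u, v = u *m A.

(* S / J has a minimal graded free resolution 0 -> s3 -> s2 -> s1 -> S, the
   last term being S in degree 0. *)
Definition minimal_graded_free_resolution
    (J : S -> Prop) (s1 s2 s3 : seq int) : Prop :=
  exists (A1 : 'M[S]_(size s1, size [:: 0 : int]))
         (A2 : 'M[S]_(size s2, size s1)) (A3 : 'M[S]_(size s3, size s2)),
    [/\ [/\ @graded_hom s1 [:: 0] A1, @graded_hom s2 s1 A2 & @graded_hom s3 s2 A3],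
        [/\ minimal_mx A1, minimal_mx A2 & minimal_mx A3],
        forall p, J p <-> exists u, (p%:M : 'rV[S]_1) = u *m A1 &
        [/\ exact_mx A2 A1, exact_mx A3 A2 &
            forall v : 'rV[S]_(size s3), v *m A3 = 0 -> v = 0]].

Definition nearly_free_exponents (d : nat) (f : S) (d1 d2 : int) : Prop :=
  exists d3 b : int,
    [/\ d1 <= d2 <= d3, d1 + d2 = d%:Z, d2 = d3, b = d2 - d%:Z + 2 &
        minimal_graded_free_resolution (jacobian_ideal f)
          (nseq 3 (d%:Z - 1))
          [:: d1 + (d%:Z - 1); d2 + (d%:Z - 1); d3 + (d%:Z - 1)]
          [:: b + 2 * (d%:Z - 1)]].

Definition NF_poly (n : nat) : S :=
  (\sum_(i < n) varx ^+ (n.-1 - i) * vary ^+ i)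
  * (vary ^+ n - varz ^+ n) * (varz ^+ n - varx ^+ n).

Lemma NF_polyE n :
  (varx - vary) * NF_poly n =
  (varx ^+ n - vary ^+ n) * (vary ^+ n - varz ^+ n) * (varz ^+ n - varx ^+ n).
Proof. by rewrite /NF_poly !mulrA -subrXX. Qed.

End PlaneCurves.

(* Main.v *)
Require Import Defs.
From mathcomp Require Import ring zify.
From mathcomp Require separable cyclotomic.
From Stdlib Require Import Classical.
Import GRing.Theory Num.Theory.
Local Open Scope ring_scope.

Set Implicit Arguments.
Unset Strict Implicit.
Unset Printing Implicit Defensive.

(** Write n = k + 2, d = 3n - 1, al = x - y, sigma = (x^n - y^n) / (x - y) and
    f = sigma (y^n - z^n) (z^n - x^n).  A vector of polynomials is read as a
    derivation, so that the syzygies of the partial derivatives of f are the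
    derivations killing f, and E = (x, y, z) is the Euler derivation.

    Everything follows from three derivations a, b, c and one polynomial p0,
    equal to z^(n-1) sigma^2 (x^n - z^n) up to a nonzero constant, with

      a f = z p0,   b f = al p0,   c f = x^k p0.

    Modulo E and up to a constant, a is (0, - y sigma, 0) and b is
    (0, 0, x^n - z^n).  The Koszul combinations r1 = al a - z b,
    r2 = x^k b - al c and r3 = x^k a - z c kill f, have degrees n + 1, 2n - 2,
    2n - 2, and satisfy x^k r1 + z r2 = al r3.  They explain the choice of
    a, b, c: the Fermat arrangement al f = 0 is free, with logarithmic
    derivations spanned by E, (x^(n+1), y^(n+1), z^(n+1)) and
    ((yz)^(n-1), (xz)^(n-1), (xy)^(n-1)), which up to the constant d and modulo
    E are r1 and r2, and removing the line al = 0 adds r3.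

    The r_i generate the syzygies, with this single
    relation.  For two derivations u, v killing f, the determinant
    det (u, v, E) is divisible by every line of f, because on a line u, v and E
    are all tangent to it; hence it is divisible by f.  As
    det (r1, r2, E) = d^2 al f, Cramer's rule expresses a syzygy v through the
    quotients det (v, r_i, E) / f, and the regularity of the sequence
    z, al, x^k removes the denominator al ([jacobian_syzygy],
    [jacobian_second_syzygy], [resolution]).

    The ideal J + (p0), where J is the Jacobian ideal, has the Hilbert-Burch
    matrix with rows (a, - z), (b, - al), (c, - x^k).  It is therefore saturated
    ([saturation_depth]), and since z, al and x^k carry p0 into J, it is the
    saturation of J ([saturated_jacobian_idealE]).  So N(f) is generated by
    p0 and killed by z and x - y: its piece in each degree is spanned by one
    multiple x^i p0.  It is not zero, because p0 in J would put 1 in the ideal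
    (z, al, x^k). *)

(** * Substitutions and linear forms *)

Section Ideals.
Variable S : comNzRingType.
Implicit Types (G : S -> Prop) (p q : S).

Lemma ideal_span_finE (n : nat) (g : 'I_n -> S) p :
  ideal_span (fun q => exists i, q = g i) p <->
  exists c : 'I_n -> S, p = \sum_i c i * g i.
Proof.
split=> [[r [c [h [hg ->]]]]|[c ->]]; last first.
  by exists n, c, g; split=> // i; exists i.
have [s hs] := fin_all_exists hg.
exists (fun j => \sum_(i | s i == j) c i); under [RHS]eq_bigr do rewrite mulr_suml.
rewrite (exchange_big_dep predT) //=; apply: eq_bigr => i _.
by rewrite (big_pred1 (s i)) ?hs // => j; rewrite eq_sym.
Qed.

Definition mdvd p q := exists h, q = h * p.

Lemma mdvdM p q h : mdvd p q -> mdvd p (h * q).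
Proof. by case=> k ->; exists (h * k); rewrite mulrA. Qed.

Lemma mdvdD p q r : mdvd p q -> mdvd p r -> mdvd p (q + r).
Proof. by case=> h -> [k ->]; exists (h + k); rewrite mulrDl. Qed.

End Ideals.

Section Substitution.
Variables (K : fieldType) (n : nat).
Local Notation S := {mpoly K[n]}.

Lemma comp_mpolyM (k : nat) (s : n.-tuple {mpoly K[k]}) :
  {morph comp_mpoly s : p q / p * q}.
Proof. exact: rmorphM. Qed.

(** The polynomials p for which this holds form a subalgebra containing the
    variables.  A polynomial killed by a substitution thus lies in the ideal of
    the X_i - s_i, which is how the reductions modulo a line, a point or the
    origin are carried out below. *)
Lemma sub_comp_mpoly (s : n.-tuple S) (p : S) :
  exists c : 'I_n -> S, p - (p \mPo s) = \sum_i c i * ('X_i - tnth s i).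
Proof.
pose P (p : S) := exists c : 'I_n -> S, p - (p \mPo s) = \sum_i c i * ('X_i - tnth s i).
have PM q r : P q -> P r -> P (q * r).
  case=> [c hc] [c' hc']; exists (fun i => c i * r + c' i * (q \mPo s)).
  have -> : q * r - ((q * r) \mPo s)
    = r * (q - (q \mPo s)) + (q \mPo s) * (r - (r \mPo s)) by rewrite comp_mpolyM; ring.
  rewrite hc hc' !mulr_sumr -big_split; apply: eq_bigr => i _ /=; ring.
have PC c : P c%:MP.
  by exists (fun=> 0); rewrite comp_mpolyC subrr big1 // => i _; rewrite mul0r.
have P1 : P 1 by rewrite -mpolyC1; apply: (PC).
have PX i : P 'X_i.
  exists (fun j => (j == i)%:R); rewrite comp_mpolyXU -tnth_nth.
  rewrite (bigD1 i) //= eqxx mul1r big1 ?addr0 // => j /negPf ->.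
  by rewrite mul0r.
have PXm m : P 'X_[m].
  rewrite mpolyXE_id; elim/big_rec: _ => [|i q _ hq]; first exact: P1.
  apply: (PM) hq; elim: (m i) => [|k ih]; first exact: P1.
  by rewrite exprS; exact: PM (PX i) ih.
elim/mpolyind: p => [|c m p _ _ [c' hc']]; first by rewrite -mpolyC0; apply: (PC).
have [c'' hc''] : P (c *: 'X_[m]) by rewrite -mul_mpolyC; exact: PM (PC c) (PXm m).
exists (fun i => c' i + c'' i); under eq_bigr do rewrite mulrDl.
by rewrite big_split /= -hc' -hc'' raddfD /=; ring.
Qed.

Lemma linformE (l : S) : l \is 1.-homog -> l = \sum_i l@_U_(i) *: 'X_i.
Proof.
move=> /dhomogP hl; apply/mpolyP => m; rewrite raddf_sum /=.
under eq_bigr do rewrite mcoeffZ mcoeffX.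
case: (boolP (mdeg m == 1)%N) => [|hm].
  rewrite mdeg_eq1 => /existsP[i /eqP ->].
  rewrite (bigD1 i) //= eqxx mulr1 big1 ?addr0 // => j hj.
  by rewrite eq_mnm1 (negPf hj) mulr0.
rewrite memN_msupp_eq0; last by apply: contra hm => /hl h; apply/eqP.
rewrite big1 // => i _; case: (U_(i)%MM =P m) hm => [<-|_ _]; rewrite ?mdeg1 //.
by rewrite mulr0.
Qed.

Lemma linform_coef_neq0 (l : S) :
  l \is 1.-homog -> l != 0 -> exists k, l@_U_(k) != 0.
Proof.
move=> hl l0; apply/existsP; rewrite -[[exists _, _]]negbK negb_exists.
apply/negP => /forallP h; case/eqP: l0; rewrite (linformE hl) big1 // => i _.
by have := h i; rewrite negbK => /eqP ->; rewrite scale0r.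
Qed.

(** Solving l = 0 for one variable gives an endomorphism of the polynomial ring
    whose kernel is the ideal of l; this makes l prime. *)
Lemma linform_kernel (l : S) : l \is 1.-homog -> l != 0 ->
  exists s : n.-tuple S, forall p, mdvd l p <-> p \mPo s = 0.
Proof.
move=> hl l0.
have [k hk] := linform_coef_neq0 hl l0.
pose s := [tuple 'X_i - (if i == k then (l@_U_(k))^-1 *: l else 0) | i < n].
have sE i : tnth s i = 'X_i - (if i == k then (l@_U_(k))^-1 *: l else 0).
  by rewrite tnth_mktuple.
have ls : l \mPo s = 0.
  rewrite {1}(linformE hl) raddf_sum /=.
  under eq_bigr do rewrite comp_mpolyZ comp_mpolyXU -tnth_nth sE scalerBr.
  rewrite sumrB -linformE // (bigD1 k) //= eqxx scalerA divff // scale1r.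
  by rewrite big1 ?addr0 ?subrr // => i /negPf ->; rewrite scaler0.
exists s => p; split=> [[h ->]|hp]; first by rewrite comp_mpolyM ls mulr0.
have [c hc] := sub_comp_mpoly s p; rewrite hp subr0 in hc.
rewrite hc (bigD1 k) //= big1 => [|i hi]; last first.
  by rewrite sE (negPf hi) subr0 subrr mulr0.
exists ((l@_U_(k))^-1 *: c k).
by rewrite addr0 sE eqxx opprB addrC subrK -scalerAl scalerAr.
Qed.

Lemma linform_prime (l p q : S) : l \is 1.-homog -> l != 0 ->
  mdvd l (p * q) -> mdvd l p \/ mdvd l q.
Proof.
move=> hl l0; have [s hs] := linform_kernel hl l0.
rewrite !hs comp_mpolyM => /eqP; rewrite mulf_eq0.
by case/orP => /eqP ->; [left | right].
Qed.

Lemma linform_nunit (l : S) : l \is 1.-homog -> l != 0 -> ~ mdvd l 1.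
Proof.
move=> hl l0; have [s hs] := linform_kernel hl l0.
by rewrite hs comp_mpoly1 => /eqP; rewrite oner_eq0.
Qed.

Lemma linform_primeX (l p : S) k : l \is 1.-homog -> l != 0 ->
  mdvd l (p ^+ k) -> mdvd l p.
Proof.
move=> hl l0; elim: k => [|k ih]; first by rewrite expr0 => /(linform_nunit hl).
by rewrite exprS => /linform_prime[].
Qed.

Lemma linform_dvd (l l' : S) : l \is 1.-homog -> l' \is 1.-homog -> l != 0 ->
  mdvd l l' -> exists c : K, l' = c *: l.
Proof.
move=> hl hl' l0 [h e].
have [h0|h0] := eqVneq h 0; first by exists 0; rewrite scale0r e h0 mul0r.
have sz (p : S) : p \is 1.-homog -> p != 0 -> msize p = 2%N.
  by move=> hp p0; rewrite mpolySpred // -(dhomog_uniq p0 hp (dhomog_msize hp)).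
have l'0 : l' != 0 by rewrite e mulf_neq0.
have := msizeM h0 l0; rewrite -e (sz l') // (sz l) // addn2 /= => -[] hs.
have /msize_poly1P[c _ hc] : msize h == 1%N by rewrite -hs.
by exists c; rewrite e hc mul_mpolyC.
Qed.

Variables (m : nat) (l : 'I_m -> S).
Hypothesis l_lin : forall i, l i \is 1.-homog.
Hypothesis l_neq0 : forall i, l i != 0.
Hypothesis l_distinct : forall i j, i != j -> ~ (exists c : K, l i = c *: l j).

Lemma linform_dvd_prod i (s : seq 'I_m) : i \notin s ->
  ~ mdvd (l i) (\prod_(j <- s) l j).
Proof.
elim: s => [|j s ih]; first by rewrite big_nil => _; apply: linform_nunit.
rewrite big_cons inE negb_or => /andP[ij /ih {}ih] /linform_prime[] //.
by move/linform_dvd => /(_ (l_lin _) (l_lin _) (l_neq0 _)); apply: l_distinct; rewrite eq_sym.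
Qed.

(** The lines are primes, and none divides a product of the others. *)
Lemma prod_lines_dvd (p : S) :
  (forall i, mdvd (l i) p) -> mdvd (\prod_i l i) p.
Proof.
move=> lp; rewrite /index_enum -enumT.
elim: (enum 'I_m) (enum_uniq 'I_m) => [|i s ih] /=.
  by move=> _; exists p; rewrite big_nil mulr1.
case/andP => si /ih[q pE].
have: mdvd (l i) (q * \prod_(j <- s) l j) by rewrite -pE.
case/linform_prime => // [[h qE]|/(linform_dvd_prod si) //].
by exists h; rewrite big_cons mulrA -qE.
Qed.
End Substitution.

(** * Derivations in three variables *)

Lemma sum3E (V : nmodType) (F : 'I_3 -> V) :
  \sum_i F i = F 0 + F 1 + F 2.
Proof.
rewrite !big_ord_recr big_ord0 /= add0r.
by congr (F _ + F _ + F _); apply: val_inj.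
Qed.

Lemma ord3P (P : 'I_3 -> Prop) : P 0 -> P 1 -> P 2 -> forall i, P i.
Proof.
move=> P0 P1 P2 [[|[|[|i]]] hi] //.
- by rewrite (_ : Ordinal hi = 0) //; apply: val_inj.
- by rewrite (_ : Ordinal hi = 1) //; apply: val_inj.
- by rewrite (_ : Ordinal hi = 2) //; apply: val_inj.
Qed.

Section Determinants.
Variable S : comNzRingType.
Implicit Types u v w x : 'rV[S]_3.

Lemma rV3P u v :
  u 0 0 = v 0 0 -> u 0 1 = v 0 1 -> u 0 2 = v 0 2 -> u = v.
Proof. by move=> h0 h1 h2; apply/rowP; apply: ord3P. Qed.

Definition det3 u v w : S :=
  u 0 0 * (v 0 1 * w 0 2 - v 0 2 * w 0 1)
  - u 0 1 * (v 0 0 * w 0 2 - v 0 2 * w 0 0)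
  + u 0 2 * (v 0 0 * w 0 1 - v 0 1 * w 0 0).

Lemma cramer3 u v w x :
  det3 v w x *: u = det3 u w x *: v + det3 v u x *: w + det3 v w u *: x.
Proof. by apply: rV3P; rewrite !mxE /det3; ring. Qed.

Lemma det3C u v w : det3 v u w = - det3 u v w.
Proof. by rewrite /det3; ring. Qed.

Lemma det3vv u w : det3 u u w = 0.
Proof. by rewrite /det3; ring. Qed.

Lemma det3D u u' v w : det3 (u + u') v w = det3 u v w + det3 u' v w.
Proof. by rewrite /det3 !mxE; ring. Qed.

Lemma det3Z s u v w : det3 (s *: u) v w = s * det3 u v w.
Proof. by rewrite /det3 !mxE; ring. Qed.

(** Column operations: a_i times the determinant is the determinant in which
    column i is replaced by the values of the linear form a on u, v, w. *)
Lemma det3_combination (a : 'I_3 -> S) u v w i :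
  exists q : 'I_3 -> S, a i * det3 u v w =
    q 0 * (\sum_j u 0 j * a j) + q 1 * (\sum_j v 0 j * a j)
    + q 2 * (\sum_j w 0 j * a j).
Proof.
rewrite !sum3E; move: i; apply: ord3P.
- exists (fun i => [:: v 0 1 * w 0 2 - v 0 2 * w 0 1;
    u 0 2 * w 0 1 - u 0 1 * w 0 2; u 0 1 * v 0 2 - u 0 2 * v 0 1]`_i).
  by rewrite /det3 /=; ring.
- exists (fun i => [:: v 0 2 * w 0 0 - v 0 0 * w 0 2;
    u 0 0 * w 0 2 - u 0 2 * w 0 0; u 0 2 * v 0 0 - u 0 0 * v 0 2]`_i).
  by rewrite /det3 /=; ring.
- exists (fun i => [:: v 0 0 * w 0 1 - v 0 1 * w 0 0;
    u 0 1 * w 0 0 - u 0 0 * w 0 1; u 0 0 * v 0 1 - u 0 1 * v 0 0]`_i).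
  by rewrite /det3 /=; ring.
Qed.

Lemma det3N u v w : det3 (- u) v w = - det3 u v w.
Proof. by rewrite /det3 !mxE; ring. Qed.
End Determinants.

Section Derivations.
Variable K : fieldType.
Local Notation S := {mpoly K[3]}.
Implicit Types (u v w : 'rV[S]_3) (f g l : S).

Definition der v f : S := \sum_i v 0 i * f^`M(i).

Definition euler : 'rV[S]_3 := \row_i 'X_i.

Lemma derE v f : der v f = v 0 0 * f^`M(0) + v 0 1 * f^`M(1) + v 0 2 * f^`M(2).
Proof. exact: sum3E. Qed.

Lemma derMr v f g : der v (f * g) = der v f * g + f * der v g.
Proof. by rewrite !derE !mderivM; ring. Qed.

Lemma derD u v f : der (u + v) f = der u f + der v f.
Proof. by rewrite !derE !mxE; ring. Qed.

Lemma derN v f : der (- v) f = - der v f.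
Proof. by rewrite !derE !mxE; ring. Qed.

Lemma derZ (s : S) v f : der (s *: v) f = s * der v f.
Proof. by rewrite !derE !mxE; ring. Qed.

Lemma der0 f : der 0 f = 0.
Proof. by rewrite !derE !mxE; ring. Qed.

Lemma der_euler d f : f \is d.-homog -> der euler f = d%:R * f.
Proof.
move=> /dhomogP hf.
have eX (m : 'X_{1..3}) : der euler 'X_[m] = (mdeg m)%:R * 'X_[m].
  rewrite mdegE natr_sum mulr_suml; apply: eq_bigr => i _.
  rewrite mxE mderivX; case: (posnP (m i)) => [->|mi]; first by rewrite scale0r mulr0 mul0r.
  rewrite -scalerAr -mpolyXD addmC submK; last by rewrite lep1mP -lt0n.
  by rewrite scaler_nat mulr_natl.
rewrite {1 2}[f]mpolyE /der; under eq_bigr do rewrite raddf_sum mulr_sumr.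
rewrite exchange_big mulr_sumr /= big_seq [RHS]big_seq; apply: eq_bigr => m mf.
under eq_bigr do rewrite mderivZ -scalerAr.
by rewrite -scaler_sumr -/(der euler _) eX -scalerAr hf.
Qed.

Lemma mderiv_linform l i : l \is 1.-homog -> l^`M(i) = (l@_U_(i))%:MP.
Proof.
move=> hl; rewrite {1}(linformE hl) raddf_sum /= (bigD1 i) //= big1 => [|j ij].
  rewrite addr0 mderivZ mderivX mnm1E eqxx scale1r.
  by rewrite -{2}[U_(i)%MM]add0m addmK mpolyX0 -alg_mpolyC.
by rewrite mderivZ mderivX mnm1E (negPf ij) scale0r scaler0.
Qed.

(** Three derivations tangent to a line are linearly dependent along it. *)
Lemma linform_dvd_det3 l u v w : l \is 1.-homog -> l != 0 ->
  mdvd l (der u l) -> mdvd l (der v l) -> mdvd l (der w l) ->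
  mdvd l (det3 u v w).
Proof.
move=> hl l0 hu hv hw.
have [i li] := linform_coef_neq0 hl l0.
have derl x : der x l = \sum_j x 0 j * (l@_U_(j))%:MP.
  by apply: eq_bigr => j _; rewrite mderiv_linform.
have [q] := det3_combination (fun j => (l@_U_(j))%:MP) u v w i.
rewrite -!derl => e.
have -> : det3 u v w = ((l@_U_(i))^-1)%:MP * ((l@_U_(i))%:MP * det3 u v w).
  by rewrite mulrA -mpolyCM mulVf // mpolyC1 mul1r.
by rewrite e; apply: mdvdM; apply: mdvdD; [apply: mdvdD|]; apply: mdvdM.
Qed.

(** Modulo the prime l_i, the Leibniz rule leaves in v(f) only v(l_i) times the
    product of the other lines, which l_i does not divide. *)
Lemma arrangement_log m (l : 'I_m -> S) v :
  (forall i, l i \is 1.-homog) -> (forall i, l i != 0) ->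
  (forall i j, i != j -> ~ (exists c : K, l i = c *: l j)) ->
  der v (\prod_i l i) = 0 -> forall i, mdvd (l i) (der v (l i)).
Proof.
move=> hl l0 ld hv i; move: hv; rewrite (bigD1 i) //= derMr => /eqP.
rewrite addr_eq0 => /eqP hv.
have: mdvd (l i) (der v (l i) * \prod_(j < m | j != i) l j).
  by exists (- der v (\prod_(j < m | j != i) l j)); rewrite hv; ring.
rewrite -big_filter; case/linform_prime => // /linform_dvd_prod [] //.
by rewrite mem_filter eqxx.
Qed.

(** The divisibility part of Saito's criterion. *)
Lemma arrangement_det3 m f u v : line_arrangement m f ->
  der u f = 0 -> der v f = 0 -> mdvd f (det3 u v euler).
Proof.
case=> l [hl l0 ld ->] hu hv; apply: prod_lines_dvd => // i.
apply: linform_dvd_det3 => //; try by apply: arrangement_log i.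
by exists 1; rewrite (der_euler (hl i)).
Qed.

Lemma arrangement_reduced m f g k : line_arrangement m f ->
  mdvd f (g ^+ k) -> mdvd f g.
Proof.
case=> l [hl l0 ld ->] hg; apply: prod_lines_dvd => // i.
apply: (@linform_primeX _ _ _ _ k) => //; case: hg => h ->.
by exists (h * \prod_(j < m | j != i) l j); rewrite (bigD1 i) //=; ring.
Qed.

Lemma arrangement_homog m f : line_arrangement m f -> f \is m.-homog.
Proof.
case=> l [hl _ _ ->]; elim: m l hl => [|m ih] l hl; first by rewrite big_ord0 dhomog1.
by rewrite big_ord_recl; apply: (dhomogM (hl _) (ih _ _)).
Qed.

Lemma arrangement_neq0 m f : line_arrangement m f -> f != 0.
Proof. by case=> l [_ l0 _ ->]; apply/prodf_neq0. Qed.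

Lemma jacobian_idealE f p : jacobian_ideal f p <-> exists v, p = der v f.
Proof.
rewrite /jacobian_ideal ideal_span_finE; split=> [[c ->]|[v ->]].
  by exists (\row_i c i); apply: eq_bigr => i _; rewrite mxE.
by exists (v 0).
Qed.
End Derivations.

(** * Syzygies from a Hilbert-Burch matrix *)

Section Dot.
Variables (S : comNzRingType) (G : 'I_3 -> S).
Implicit Types u v w : 'rV[S]_3.

Definition dot v : S := \sum_i v 0 i * G i.

Lemma dotD u v : dot (u + v) = dot u + dot v.
Proof. by rewrite /dot !sum3E !mxE; ring. Qed.

Lemma dotN v : dot (- v) = - dot v.
Proof. by rewrite /dot !sum3E !mxE; ring. Qed.

Lemma dotZ (s : S) v : dot (s *: v) = s * dot v.
Proof. by rewrite /dot !sum3E !mxE; ring. Qed.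

Definition dotE := (dotD, dotN, dotZ).
Definition det3E := (@det3D S, @det3N S, @det3Z S, @det3vv S).
End Dot.

(** Here dot G v is the value on f of the derivation v, with G the gradient
    of f. *)
Section Syzygies.
Variables (S : idomainType) (G : 'I_3 -> S) (E a b c : 'rV[S]_3).
Variables (f al z g e e' p0 : S).

Variables (r1 r2 r3 : 'rV[S]_3).
Hypotheses (r1E : r1 = al *: a - z *: b) (r2E : r2 = g *: b - al *: c).
Hypothesis r3E : r3 = g *: a - z *: c.

Hypotheses (al0 : al != 0) (f0 : f != 0) (EG0 : dot G E != 0) (e'e : e' * e = 1).
Hypotheses (aG : dot G a = z * p0) (bG : dot G b = al * p0) (cG : dot G c = g * p0).
Hypothesis r1r2 : det3 r1 r2 E = e * (al * f).
Hypothesis dvd_det : forall u v, dot G u = 0 -> dot G v = 0 -> mdvd f (det3 u v E).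
Hypothesis z_regular : forall t s, z * t = al * s -> mdvd al t.
Hypothesis g_regular : forall p q s, g * p + z * q = al * s ->
  exists t p1 q1, p = z * t + al * p1 /\ q = al * q1 - g * t.

Lemma rel_r : al *: r3 = g *: r1 + z *: r2.
Proof. by rewrite r1E r2E r3E; apply: rV3P; rewrite !mxE; ring. Qed.

Lemma r1G : dot G r1 = 0. Proof. by rewrite r1E !dotE aG bG; ring. Qed.
Lemma r2G : dot G r2 = 0. Proof. by rewrite r2E !dotE bG cG; ring. Qed.
Lemma r3G : dot G r3 = 0. Proof. by rewrite r3E !dotE aG cG; ring. Qed.

(** Pairing al r3 = g r1 + z r2 with r1 or r2 and E leaves a multiple of
    det (r1, r2, E), from which al cancels. *)
Lemma det_r1_r3 : det3 r1 r3 E = e * (z * f).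
Proof.
apply: (mulfI al0); rewrite det3C mulrN -det3Z rel_r !det3E det3C r1r2; ring.
Qed.

Lemma det_r2_r3 : det3 r2 r3 E = - e * (g * f).
Proof.
by apply: (mulfI al0); rewrite det3C mulrN -det3Z rel_r !det3E r1r2; ring.
Qed.

(** By Cramer's rule w is a multiple of E, and E does not kill f. *)
Lemma syz_eq0 w : dot G w = 0 -> det3 w r1 E = 0 -> det3 w r2 E = 0 -> w = 0.
Proof.
move=> wG w1 w2.
have e0 : e != 0 by apply: contra_eq_neq e'e => ->; rewrite mulr0 eq_sym oner_eq0.
have := cramer3 w r1 r2 E; rewrite w2 (det3C w r1) w1 oppr0 !scale0r !add0r => we.
have D0 : det3 r1 r2 w = 0.
  have := congr1 (dot G) we; rewrite !dotZ wG mulr0 => /esym /eqP.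
  by rewrite mulf_eq0 (negPf EG0) orbF => /eqP.
apply/rowP => i; have := congr1 (fun x : 'rV_3 => x 0 i) we.
rewrite D0 scale0r r1r2 !mxE => /eqP.
by rewrite !mulf_eq0 (negPf e0) (negPf al0) (negPf f0) => /eqP.
Qed.

(** The numbers p, q, s with det (v, r_i, E) = p f, q f, s f satisfy
    g p + z q = al s, and regularity of z, al, g solves this for the three
    coefficients of v. *)
Lemma syz_span v : dot G v = 0 ->
  exists t1 t2 t3, v = t1 *: r1 + t2 *: r2 + t3 *: r3.
Proof.
move=> vG.
have [p hp] := dvd_det vG r1G; have [q hq] := dvd_det vG r2G.
have [s hs] := dvd_det vG r3G.
(* the equation g p + z q = al s, read off from al r3 = g r1 + z r2 *)
have [t [p1 [q1 [pE qE]]]] : exists t p1 q1, p = z * t + al * p1 /\ q = al * q1 - g * t.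
  apply: (g_regular (s := s)); apply: (mulIf f0).
  rewrite mulrDl -!mulrA -hs -hp -hq !(det3C _ v) !mulrN -!det3Z rel_r.
  by rewrite !det3E; ring.
(* coefficients chosen so that both sides have the same determinants with
   r1, E and with r2, E *)
exists (e' * q1), (- (e' * p1)), (- (e' * t)).
apply/eqP; rewrite -subr_eq0; apply/eqP; apply: syz_eq0.
- by rewrite !dotE vG r1G r2G r3G; ring.
- rewrite !det3E hp pE (det3C r1 r2) r1r2 (det3C r1 r3) det_r1_r3.
  by rewrite -[(z * t + al * p1) * f]mul1r -e'e; ring.
- rewrite !det3E hq qE r1r2 (det3C r2 r3) det_r2_r3.
  by rewrite -[(al * q1 - g * t) * f]mul1r -e'e; ring.
Qed.

(** Taking determinants with r1 and E, then with r2 and E, turns the relation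
    into two equations of Koszul type. *)
Lemma syz_rel t1 t2 t3 : t1 *: r1 + t2 *: r2 + t3 *: r3 = 0 ->
  exists w, [/\ t1 = w * g, t2 = w * z & t3 = - (w * al)].
Proof.
move=> h.
have e0 : e != 0 by apply: contra_eq_neq e'e => ->; rewrite mulr0 eq_sym oner_eq0.
have ef0 : e * f != 0 by rewrite mulf_neq0.
have det0 w : det3 0 w E = 0 by rewrite -(scale0r r1) det3Z mul0r.
have h1 : z * (- t3) = al * t2.
  have := det0 r1; rewrite -h !det3E (det3C r1 r2) r1r2 (det3C r1 r3) det_r1_r3 => h1.
  by apply: (mulfI ef0); apply/eqP; rewrite -subr_eq0; apply/eqP; rewrite -[RHS]h1; ring.
have h2 : al * t1 = g * (- t3).
  have := det0 r2; rewrite -h !det3E r1r2 (det3C r2 r3) det_r2_r3 => h2.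
  by apply: (mulfI ef0); apply/eqP; rewrite -subr_eq0; apply/eqP; rewrite -[RHS]h2; ring.
have [w hw] := z_regular h1; exists w; split.
- by apply: (mulfI al0); rewrite h2 hw; ring.
- by apply: (mulfI al0); rewrite -h1 hw; ring.
- by rewrite -hw opprK.
Qed.

(** The rows (a, - z), (b, - al), (c, - g) generate the relations between the
    generators of J + (p0).  Multiplying such a relation by z and by al, and
    replacing z p0 and al p0 by their expressions, gives two syzygies of the
    derivatives of f; comparing them puts U in the ideal
    (z, al, g), which reduces the claim to U = 0. *)
Lemma syz_extended U W : U * p0 + dot G W = 0 -> exists c1 c2 c3,
  W = c1 *: a + c2 *: b + c3 *: c /\ U = - (c1 * z + c2 * al + c3 * g).
Proof.
move=> h; have WG : dot G W = - (U * p0) by apply/eqP; rewrite -addr_eq0 addrC h.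
have [t1 [t2 [t3 ht]]] : exists t1 t2 t3, z *: W + U *: a = t1 *: r1 + t2 *: r2 + t3 *: r3.
  by apply: syz_span; rewrite !dotE WG aG; ring.
have [s1 [s2 [s3 hs]]] : exists t1 t2 t3, al *: W + U *: b = t1 *: r1 + t2 *: r2 + t3 *: r3.
  by apply: syz_span; rewrite !dotE WG bG; ring.
have [w [hw _ _]] : exists w, [/\ al * t1 - z * s1 - U = w * g,
    al * t2 - z * s2 = w * z & al * t3 - z * s3 = - (w * al)].
  apply: syz_rel.
  have -> : (al * t1 - z * s1 - U) *: r1 + (al * t2 - z * s2) *: r2
      + (al * t3 - z * s3) *: r3
    = al *: (t1 *: r1 + t2 *: r2 + t3 *: r3) - z *: (s1 *: r1 + s2 *: r2 + s3 *: r3) - U *: r1.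
    by apply: rV3P; rewrite !mxE; ring.
  by rewrite -ht -hs r1E; apply: rV3P; rewrite !mxE; ring.
have UE : U = - (s1 * z + (- t1) * al + w * g) by rewrite -hw; ring.
have [u1 [u2 [u3 hu]]] : exists u1 u2 u3,
    W - s1 *: a + t1 *: b - w *: c = u1 *: r1 + u2 *: r2 + u3 *: r3.
  by apply: syz_span; rewrite !dotE WG aG bG cG UE; ring.
exists (s1 + u1 * al + u3 * g), (u2 * g - t1 - u1 * z), (w - u2 * al - u3 * z).
split; last by rewrite UE; ring.
have -> : W = (u1 *: r1 + u2 *: r2 + u3 *: r3) + s1 *: a - t1 *: b + w *: c.
  by rewrite -hu; apply: rV3P; rewrite !mxE; ring.
by rewrite r1E r2E r3E; apply: rV3P; rewrite !mxE; ring.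
Qed.
End Syzygies.

(** * Homogeneous components and the sequence z, x - y, x^k *)

Section Homogeneous.
Variables (K : fieldType) (n : nat).
Local Notation S := {mpoly K[n]}.

Lemma mderiv_homog d (f : S) i : f \is d.-homog -> f^`M(i) \is (d.-1).-homog.
Proof.
move=> /dhomogP hf; apply/dhomogP => m; rewrite mcoeff_msupp mcoeff_mderiv => h.
have /hf : (m + U_(i))%MM \in msupp f.
  by rewrite mcoeff_msupp; apply: contra_neq h => ->; rewrite mul0rn.
by rewrite /= mdegD mdeg1 addn1 => <-.
Qed.

Lemma pihomogM d e (p g : S) : g \is e.-homog ->
  pihomog mdeg (d + e) (p * g) = pihomog mdeg d p * g.
Proof.
move=> hg; elim/mpolyind: p => [|c m p _ _ hp]; first by rewrite mul0r !raddf0 mul0r.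
rewrite mulrDl -scalerAl !linearP /= hp mulrDl -scalerAl; congr (_ *: _ + _).
have hm : 'X_[m] * g \is (mdeg m + e).-homog by rewrite dhomogM ?dhomogX.
rewrite pihomogX /=; case: eqP => [<-|/eqP md]; first by rewrite pihomog_dE.
by rewrite mul0r (pihomog_ne0 _ hm) // eqn_add2r.
Qed.

Lemma pihomogM_lt d e (p g : S) : g \is e.-homog -> (d < e)%N ->
  pihomog mdeg d (p * g) = 0.
Proof.
move=> hg de; elim/mpolyind: p => [|c m p _ _ hp]; first by rewrite mul0r raddf0.
rewrite mulrDl -scalerAl linearP /= hp addr0.
have hm : 'X_[m] * g \is (mdeg m + e).-homog by rewrite dhomogM ?dhomogX.
by rewrite (pihomog_ne0 _ hm) ?scaler0 // neq_ltn (leq_trans de) ?leq_addl ?orbT.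
Qed.

Lemma pihomogM_mul d e (p g : S) : g \is e.-homog ->
  exists q, pihomog mdeg d (p * g) = q * g.
Proof.
move=> hg; case: (leqP e d) => [ed|de]; last first.
  by exists 0; rewrite (pihomogM_lt p hg de) mul0r.
by exists (pihomog mdeg (d - e) p); rewrite -(pihomogM _ _ hg) subnK.
Qed.
End Homogeneous.

Section ThreeVariables.
Variable K : fieldType.
Local Notation S := {mpoly K[3]}.

Definition subst3 (p q r : S) : 3.-tuple S := [tuple of [:: p; q; r]].

Lemma sub_subst3 (s : 3.-tuple S) (p : S) : exists c0 c1 c2 : S,
  p - (p \mPo s) = c0 * ('X_0 - s`_0) + c1 * ('X_1 - s`_1) + c2 * ('X_2 - s`_2).
Proof.
have [c ->] := sub_comp_mpoly s p; exists (c 0), (c 1), (c 2).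
by rewrite sum3E !(tnth_nth 0).
Qed.

Lemma comp_X0 (s : 3.-tuple S) : 'X_(0 : 'I_3) \mPo s = s`_0. Proof. exact: comp_mpolyXU. Qed.
Lemma comp_X1 (s : 3.-tuple S) : 'X_(1 : 'I_3) \mPo s = s`_1. Proof. exact: comp_mpolyXU. Qed.
Lemma comp_X2 (s : 3.-tuple S) : 'X_(2 : 'I_3) \mPo s = s`_2. Proof. exact: comp_mpolyXU. Qed.

Lemma var_neq0 (i : 'I_3) : 'X_i != 0 :> S.
Proof. by rewrite -msupp_eq0 msuppX. Qed.

Let x : S := 'X_0.
Let y : S := 'X_1.
Let z : S := 'X_2.
Let al := x - y.

Lemma al_neq0 : al != 0.
Proof.
apply/eqP => h; have /eqP := congr1 (mcoeff U_(0 : 'I_3)) h.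
by rewrite mcoeffB !mcoeffXU mcoeff0 /= subr0 oner_eq0.
Qed.

Lemma al_z_regular t s : z * t = al * s -> mdvd al t.
Proof.
move=> h; pose u := subst3 x x z.
have hu : t \mPo u = 0.
  have := congr1 (comp_mpoly u) h; rewrite !comp_mpolyM comp_mpolyB.
  rewrite comp_X0 comp_X1 comp_X2 /= subrr mul0r => /eqP.
  by rewrite mulf_eq0 (negPf (var_neq0 2)) => /eqP.
have [c0 [c1 [c2]]] := sub_subst3 u t; rewrite hu subr0 /= => ->.
by exists (- c1); rewrite /al /x /y /z; ring.
Qed.

Lemma mod_al_z p : p \mPo subst3 x x 0 = 0 -> exists t s, p = z * t + al * s.
Proof.
move=> hu; have [c0 [c1 [c2]]] := sub_subst3 (subst3 x x 0) p.
rewrite hu subr0 /= => ->; exists c2, (- c1); rewrite /al /x /y /z; ring.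
Qed.

Lemma al_z_xk_regular k p q s : x ^+ k * p + z * q = al * s ->
  exists t p1 q1, p = z * t + al * p1 /\ q = al * q1 - x ^+ k * t.
Proof.
move=> h; pose u := subst3 x x 0.
have hp : p \mPo u = 0.
  have := congr1 (comp_mpoly u) h; rewrite comp_mpolyD !comp_mpolyM comp_mpolyB.
  rewrite comp_X0 comp_X1 comp_X2 /= subrr !mul0r addr0 => /eqP.
  have -> : (x ^+ k) \mPo u = x ^+ k.
    by elim: k {h} => [|k ih]; rewrite ?comp_mpoly1 // exprS comp_mpolyM ih comp_X0.
  by rewrite mulf_eq0 expf_eq0 (negPf (var_neq0 0)) andbF => /eqP.
have [t [p1 pE]] := mod_al_z hp.
have [q1 q1E] : mdvd al (x ^+ k * t + q).
  apply: (@al_z_regular _ (s - x ^+ k * p1)).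
  rewrite mulrBr -h pE; ring.
by exists t, p1, q1; split=> //; rewrite mulrC -q1E addrAC subrr add0r.
Qed.

(** Modulo z and x - y the ring becomes K[x], whose graded pieces are lines. *)
Lemma mod_al_z_homog k (p : S) : p \is k.-homog ->
  exists (c : K) t s, p = c *: x ^+ k + z * t + al * s.
Proof.
move=> /dhomogP hp.
have [c hc] : exists c : K, p \mPo subst3 x x 0 = c *: x ^+ k.
  (* after y := x and z := 0 only the monomials without z survive *)
  exists (\sum_(m <- msupp p | m 2 == 0%N) p@_m).
  rewrite comp_mpolyE [RHS]scaler_suml [RHS]big_mkcond /= big_seq [RHS]big_seq.
  apply: eq_bigr => m /hp /= mk; rewrite !big_ord_recr big_ord0 /= mul1r.
  rewrite !(tnth_nth 0) /=.
  have -> : m ord_max = m 2 by congr (m _); apply: val_inj.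
  case: eqP => [m2|/eqP m2]; last by rewrite expr0n (negPf m2) mulr0 scaler0.
  rewrite m2 expr0 mulr1 -exprD -mk mdegE !big_ord_recr big_ord0 /= add0n.
  have -> : m ord_max = m 2 by congr (m _); apply: val_inj.
  by rewrite m2 addn0.
have [c0 [c1 [c2 h]]] := sub_subst3 (subst3 x x 0) p.
exists c, c2, (- c1); rewrite -hc -[LHS](subrK (p \mPo subst3 x x 0)) h /=.
by rewrite /al /x /y /z; ring.
Qed.

Lemma irrelevant_idealE (p : S) : irrelevant_ideal p <->
  exists c0 c1 c2, p = c0 * x + c1 * y + c2 * z.
Proof.
rewrite /irrelevant_ideal ideal_span_finE; split=> [[c ->]|[c0 [c1 [c2 ->]]]].
  by exists (c 0), (c 1), (c 2); rewrite sum3E.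
by exists (fun i => [:: c0; c1; c2]`_i); rewrite sum3E.
Qed.

Lemma irrelevant_homog k (p : S) : p \is k.+1.-homog -> irrelevant_ideal p.
Proof.
move=> /dhomogP hp; apply/irrelevant_idealE.
have [c0 [c1 [c2]]] := sub_subst3 (subst3 0 0 0) p.
have -> : p \mPo subst3 0 0 0 = 0.
  rewrite comp_mpolyE big_seq big1 // => m /hp /=; rewrite mdegE => mk.
  have [i mi] : exists i, m i != 0%N.
    apply/existsP; rewrite -[[exists _, _]]negbK negb_exists; apply/negP => /forallP h.
    by move: mk; rewrite big1 // => i _; have := h i; rewrite negbK => /eqP.
  rewrite (bigD1 i) //=; move: i mi; apply: ord3P => mi;
    by rewrite !(tnth_nth 0) /= expr0n (negPf mi) mul0r scaler0.
by rewrite !subr0 => ->; exists c0, c1, c2.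
Qed.
End ThreeVariables.

(** * Arrangements with a Hilbert-Burch matrix *)

(** An arrangement f for which J + (p0) has the Hilbert-Burch matrix with rows
    (a, - z), (b, - al), (c, - x^k), nondegenerate in the sense of [r1r2], and
    which avoids the point (0 : 2 : 1).  J is the Jacobian ideal and
    I = J + (p0) turns out to be its saturation. *)
Section HilbertBurch.
Variable K : numFieldType.
Local Notation S := {mpoly K[3]}.
Let x : S := 'X_0.
Let y : S := 'X_1.
Let z : S := 'X_2.
Let al := x - y.

Variables (d k T : nat) (f p0 : S) (a b c r1 r2 r3 : 'rV[S]_3) (e : K).
Let g := x ^+ k.
Hypotheses (d_gt0 : (0 < d)%N) (k_gt0 : (0 < k)%N) (e0 : e != 0).
Hypothesis f_lines : line_arrangement d f.
Hypothesis (r1E : r1 = al *: a - z *: b).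
Hypothesis (r2E : r2 = g *: b - al *: c).
Hypothesis (r3E : r3 = g *: a - z *: c).
Hypothesis af : der a f = z * p0.
Hypothesis bf : der b f = al * p0.
Hypothesis cf : der c f = g * p0.
Hypothesis r1r2 : det3 r1 r2 (euler K) = e%:MP * (al * f).
Hypothesis fP : f \mPo subst3 0 (z + z) z != 0.
Hypothesis p0_homog : p0 \is T.-homog.

Let J (p : S) := exists v, p = der v f.
Let I (p : S) := exists u v, p = u * p0 + der v f.

Local Notation G := (fun i => f^`M(i)).

Let al0 : al != 0. Proof. exact: al_neq0. Qed.
Let f0 : f != 0. Proof. exact: arrangement_neq0 f_lines. Qed.
Let f_homog : f \is d.-homog. Proof. exact: arrangement_homog f_lines. Qed.

Let euler0 : dot G (euler K) != 0.
Proof.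
rewrite -[dot _ _]/(der (euler K) f) (der_euler f_homog) mulf_neq0 //.
by rewrite -mpolyC_nat mpolyC_eq0 pnatr_eq0 -lt0n.
Qed.

Let e'e : (e^-1)%:MP * e%:MP = 1 :> S.
Proof. by rewrite -mpolyCM mulVf // mpolyC1. Qed.

Let dvd_det u v : dot G u = 0 -> dot G v = 0 -> mdvd f (det3 u v (euler K)).
Proof. exact: arrangement_det3 f_lines. Qed.

Lemma jacobian_syzygy v : der v f = 0 ->
  exists t1 t2 t3, v = t1 *: r1 + t2 *: r2 + t3 *: r3.
Proof.
exact: (syz_span r1E r2E r3E al0 f0 euler0 e'e af bf cf r1r2 dvd_det
  (@al_z_xk_regular _ k)).
Qed.

Lemma jacobian_second_syzygy t1 t2 t3 : t1 *: r1 + t2 *: r2 + t3 *: r3 = 0 ->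
  exists w, [/\ t1 = w * g, t2 = w * z & t3 = - (w * al)].
Proof.
exact: (syz_rel r1E r2E r3E al0 f0 e'e r1r2 (@al_z_regular _)).
Qed.

Let I_syzygy U W : U * p0 + der W f = 0 -> exists c1 c2 c3,
  W = c1 *: a + c2 *: b + c3 *: c /\ U = - (c1 * z + c2 * al + c3 * g).
Proof.
exact: (syz_extended r1E r2E r3E al0 f0 euler0 e'e af bf cf r1r2 dvd_det
  (@al_z_regular _) (@al_z_xk_regular _ k)).
Qed.

(** Otherwise 1 would be a combination of z, al and x^k, which vanish at the
    origin. *)
Lemma p0_notin_jacobian : ~ J p0.
Proof.
case=> v hv; have : 1 * p0 + der (- v) f = 0 by rewrite derN -hv; ring.
case/I_syzygy => c1 [c2 [c3 [_ /(congr1 (comp_mpoly (subst3 0 0 0)))]]].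
rewrite comp_mpolyN !comp_mpolyD !comp_mpolyM comp_mpolyB comp_mpoly1 comp_X0 comp_X1 comp_X2 /=.
have -> : g \mPo subst3 0 0 0 = 0.
  by rewrite /g; case: k k_gt0 => // k' _; rewrite exprS comp_mpolyM comp_X0 /= mul0r.
by rewrite subrr !mulr0 !addr0 oppr0 => /eqP; rewrite oner_eq0.
Qed.

Let det3_comp (s : 3.-tuple S) (u v w : 'rV[S]_3) :
  det3 u v w \mPo s
  = det3 (map_mx (comp_mpoly s) u) (map_mx (comp_mpoly s) v) (map_mx (comp_mpoly s) w).
Proof.
by rewrite /det3 !comp_mpolyD !comp_mpolyN !comp_mpolyM
  !comp_mpolyD !comp_mpolyN !comp_mpolyM !mxE.
Qed.

(** Depth at least one for the quotient by J + (p0).  The forms x and y - 2z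
    cut out the point (0 : 2 : 1), which by [fP] is off the curve; there the
    matrix of relations keeps full rank because det (r1, r3, E) is a multiple
    of z f.  So a combination of its rows with entries in the ideal
    (x, y - 2z) has its coefficients in that ideal, and the two expressions of x q and (y - 2z) q can be corrected
    until they are divisible by x. *)
Lemma saturation_depth q : I (x * q) -> I ((y - (z + z)) * q) -> I q.
Proof.
set l := y - (z + z).
case=> u [w hw] [u' [w' hw']]; pose s := subst3 0 (z + z) z.
have xs : x \mPo s = 0 by rewrite comp_X0.
have zs : z \mPo s = z by rewrite comp_X2.
have ls : l \mPo s = 0 by rewrite !comp_mpolyB comp_mpolyD comp_X1 comp_X2 /= subrr.
have h : (l * u - x * u') * p0 + der (l *: w - x *: w') f = 0.
  rewrite derD derN !derZ; apply/eqP; rewrite -subr_eq0; apply/eqP.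
  have -> : (l * u - x * u') * p0 + (l * der w f - x * der w' f) - 0
    = l * (u * p0 + der w f) - x * (u' * p0 + der w' f) by ring.
  by rewrite -hw -hw'; ring.
have [c1 [c2 [c3 [hW hU]]]] := I_syzygy h.
(* c2 r1 + c3 r3 is - z W - U a with W = l w - x w' and U = l u - x u', both
   killed by s *)
have comp_d v : det3 (c2 *: r1 + c3 *: r3) v (euler K) \mPo s = 0.
  have -> : c2 *: r1 + c3 *: r3 = - z *: (l *: w - x *: w') - (l * u - x * u') *: a.
    by rewrite hW hU r1E r3E; apply: rV3P; rewrite !mxE; ring.
  rewrite det3_comp [X in det3 X _ _](_ : _ = 0); first by rewrite -(scale0r 0) det3Z mul0r.
  apply/rowP => i; rewrite !mxE.
  have -> : - z * (l * w 0 i - x * w' 0 i) - (l * u - x * u') * a 0 i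
     = l * (- z * w 0 i - u * a 0 i) + x * (z * w' 0 i + u' * a 0 i) by ring.
  by rewrite comp_mpolyD !comp_mpolyM xs ls !mul0r addr0.
have e1 : e%:MP != 0 :> S by rewrite mpolyC_eq0.
have zne0 : z != 0 by exact: var_neq0.
have er3 := det_r1_r3 r1E r2E r3E al0 r1r2.
have c2s : c2 \mPo s = 0.
  have := comp_d r3; rewrite det3D !det3Z det3vv mulr0 addr0 er3 !comp_mpolyM zs.
  rewrite comp_mpolyC => /eqP; rewrite !mulf_eq0 (negPf e1) (negPf zne0) (negPf fP).
  by rewrite !orbF => /eqP.
have c3s : c3 \mPo s = 0.
  have := comp_d r1; rewrite det3D !det3Z det3vv mulr0 add0r det3C er3 !comp_mpolyM.
  rewrite comp_mpolyN !comp_mpolyM zs.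
  rewrite comp_mpolyC => /eqP; rewrite mulf_eq0 oppr_eq0 !mulf_eq0.
  by rewrite (negPf e1) (negPf zne0) (negPf fP) !orbF => /eqP.
have c1s : c1 \mPo s = 0.
  have := congr1 (comp_mpoly s) hU.
  rewrite comp_mpolyB comp_mpolyN !comp_mpolyD !comp_mpolyM xs ls zs c2s c3s.
  rewrite !mul0r !addr0 subrr => /eqP.
  by rewrite eq_sym oppr_eq0 mulf_eq0 (negPf zne0) orbF => /eqP.
have split_s p : p \mPo s = 0 -> exists p1 p2, p = x * p1 + l * p2.
  move=> ps; have [q0 [q1 [q2]]] := sub_subst3 s p; rewrite ps !subr0 /= => ->.
  by exists q0, q1; rewrite subrr mulr0 addr0 (mulrC x) (mulrC l).
have [c11 [c12 c1E]] := split_s _ c1s.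
have [c21 [c22 c2E]] := split_s _ c2s.
have [c31 [c32 c3E]] := split_s _ c3s.
(* x is prime and does not divide l, where y has coefficient 1 *)
have x_dvd p p' : l * p = x * p' -> mdvd x p.
  move=> lp; have xh : x \is 1.-homog by rewrite dhomogX /= mdeg1.
  have : mdvd x (l * p) by exists p'; rewrite lp mulrC.
  case/(linform_prime xh (var_neq0 _ _)) => // -[h'].
  move/(congr1 (mcoeff U_(1 : 'I_3))); rewrite mcoeffB mcoeffD !mcoeffXU /=.
  rewrite addr0 subr0 => /eqP.
  have -> : (h' * x)@_U_(1) = 0.
    rewrite memN_msupp_eq0 //; apply/negP => /msuppM_le /allpairsP[[m m'] [_]] /=.
    rewrite msuppX inE => /eqP -> /mnmP /(_ 0); rewrite mnmDE !mnm1E /= addn1 //.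
  by rewrite oner_eq0.
have [v hv] : exists v, w - (c12 *: a + c22 *: b + c32 *: c) = x *: v.
  have ex i : exists vi, (w - (c12 *: a + c22 *: b + c32 *: c)) 0 i = vi * x.
    apply: (@x_dvd _ (w' 0 i + c11 * a 0 i + c21 * b 0 i + c31 * c 0 i)).
    have := congr1 (fun v : 'rV_3 => v 0 i) hW; rewrite !mxE c1E c2E c3E => hi.
    apply/eqP; rewrite -subr_eq0; apply/eqP.
    have -> : l * (w 0 i - (c12 * a 0 i + c22 * b 0 i + c32 * c 0 i))
       - x * (w' 0 i + c11 * a 0 i + c21 * b 0 i + c31 * c 0 i)
      = l * w 0 i - x * w' 0 i - ((x * c11 + l * c12) * a 0 i
          + (x * c21 + l * c22) * b 0 i + (x * c31 + l * c32) * c 0 i) by ring.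
    by rewrite hi subrr.
  have [vi hvi] := fin_all_exists ex.
  by exists (\row_i vi i); apply/rowP => i; rewrite hvi !mxE mulrC.
have [t ht] : mdvd x (u + (c12 * z + c22 * al + c32 * g)).
  apply: (@x_dvd _ (u' - (c11 * z + c21 * al + c31 * g))).
  apply/eqP; rewrite -subr_eq0; apply/eqP.
  have -> : l * (u + (c12 * z + c22 * al + c32 * g))
      - x * (u' - (c11 * z + c21 * al + c31 * g))
    = (l * u - x * u') + ((x * c11 + l * c12) * z + (x * c21 + l * c22) * al
       + (x * c31 + l * c32) * g) by ring.
  by rewrite -c1E -c2E -c3E hU; ring.
exists t, v; apply: (mulfI (var_neq0 _ 0)); rewrite -/x hw mulrDr -derZ -hv mulrA.
rewrite (mulrC x) -ht derD derN !derD !derZ af bf cf; ring.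
Qed.

(** Removes the powers of the maximal ideal one factor at a time. *)
Lemma saturation_closed (j : nat) (p : S) :
  (forall h : 'I_j -> S, (forall i, irrelevant_ideal (h i)) -> I ((\prod_i h i) * p)) -> I p.
Proof.
elim: j p => [|j ih] p hp.
  have := hp (fun=> 0); rewrite big_ord0 mul1r; apply; case=> //.
apply: ih => h hm.
have ext l : irrelevant_ideal l -> I (l * ((\prod_i h i) * p)).
  move=> lm; pose h' i := if unlift ord0 i is Some i' then h i' else l.
  have := hp h'; rewrite big_ord_recl [h' ord0]/h' unlift_none.
  rewrite [\prod_(i < j) h' _](_ : _ = \prod_i h i); last first.
    by apply: eq_bigr => i _; rewrite /h' liftK.
  by rewrite mulrA; apply=> i; rewrite /h'; case: (unlift _ _).
apply: saturation_depth; apply: ext; apply/irrelevant_idealE.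
  by exists 1, 0, 0; rewrite -/x; ring.
by exists 0, 1, (-1 - 1); rewrite -/x -/y -/z; ring.
Qed.

Let JD p q : J p -> J q -> J (p + q).
Proof. by case=> u -> [v ->]; exists (u + v); rewrite derD. Qed.
Let JM p q : J q -> J (p * q).
Proof. by case=> v ->; exists (p *: v); rewrite derZ. Qed.
Let J0 : J 0. Proof. by exists 0; rewrite der0. Qed.

Let Jzp0 t : J (z * t * p0).
Proof. by exists (t *: a); rewrite derZ af; ring. Qed.
Let Jalp0 t : J (al * t * p0).
Proof. by exists (t *: b); rewrite derZ bf; ring. Qed.

(** The annihilator of p0 modulo J contains z and x - y, so every element of
    the irrelevant ideal acts on p0 as a multiple of x. *)
Lemma prod_irrelevant_p0 (j : nat) (h : 'I_j -> S) :
  (forall i, irrelevant_ideal (h i)) ->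
  exists s, J ((\prod_i h i - s * x ^+ j) * p0).
Proof.
elim: j h => [|j ih] h hm.
  by exists 1; rewrite big_ord0 expr0 mulr1 subrr mul0r; exact: J0.
have [s hs] := ih _ (fun i => hm (lift ord0 i)).
have [c0 [c1 [c2 h0]]] := (irrelevant_idealE _).1 (hm ord0).
exists ((c0 + c1) * s); rewrite big_ord_recl h0.
set P := \prod_i _ in hs *.
have -> : ((c0 * 'X_0 + c1 * 'X_1 + c2 * 'X_2) * P - (c0 + c1) * s * x ^+ j.+1) * p0
  = (c0 + c1) * x * ((P - s * x ^+ j) * p0) + (z * (c2 * P) * p0 + al * (- c1 * P) * p0).
  by rewrite exprS -/x -/y -/z /al; ring.
apply: JD; first exact: JM.
by apply: JD; [apply: Jzp0|apply: Jalp0].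
Qed.

Lemma saturated_jacobian_idealE p : saturated_jacobian_ideal f p <-> I p.
Proof.
split=> [[j hj]|[u [v ->]]].
  apply: (@saturation_closed j) => h hm; have /jacobian_idealE[v ->] :
    jacobian_ideal f ((\prod_i h i) * p).
    apply: hj; exists 1%N, (fun=> 1), (fun=> \prod_i h i).
    by split=> [_|]; [exists h|rewrite big_ord1 mul1r].
  by exists 0, v; rewrite mul0r add0r.
exists k => _ [r [s [q [hq ->]]]]; apply/jacobian_idealE; rewrite -/(J _).
rewrite mulr_suml; elim/big_ind: _ => [||i _]; [exact: J0|exact: JD|].
have [h [hm ->]] := hq i; have [s' hs] := prod_irrelevant_p0 hm.
set P := \prod_i _ in hs *.
have -> : s i * P * (u * p0 + der v f) = s i * u * ((P - s' * x ^+ k) * p0)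
   + s i * u * s' * (x ^+ k * p0) + (s i * P) * der v f by ring.
apply: JD; last by apply: JM; exists v.
apply: JD; apply: JM => //; by exists c; rewrite cf.
Qed.

Lemma J_pihomog j p : J p -> J (pihomog mdeg j p).
Proof.
case=> v ->; rewrite /der raddf_sum /=; elim/big_ind: _ => [||i _]; [exact: J0|exact: JD|].
have [q ->] := pihomogM_mul j (v 0 i) (mderiv_homog i f_homog).
by apply: JM; exists (\row_j (j == i)%:R); rewrite /der (bigD1 i) //= mxE eqxx mul1r
  big1 ?addr0 // => j' /negPf ji; rewrite mxE ji mul0r.
Qed.

(** In the component of degree j of u p0 + v(f), only the component of u of
    degree j - T matters, and modulo z and x - y this is a multiple of
    x^(j - T). *)
Lemma saturation_quotient_dim j : exists2 r, (r <= 1)%N &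
  quotient_dim (graded_part (saturated_jacobian_ideal f) j)
               (graded_part (jacobian_ideal f) j) r.
Proof.
have homogJ q r : q \is j.-homog -> J (q - r) -> jacobian_ideal f (q - pihomog mdeg j r).
  by move=> hq /(J_pihomog j); rewrite raddfB /= pihomog_dE // => /jacobian_idealE.
case: (leqP T j) => [Tj|jT]; last first.
  exists 0%N => //; exists (fun=> 0); split=> [[]//|c' _ []//|p [/saturated_jacobian_idealE Ip hp]].
  exists (fun=> 0); rewrite big_ord0 subr0; split=> //.
  case: Ip => u [v pE]; rewrite -[p]subr0 -(pihomogM_lt u p0_homog jT).
  by apply: homogJ => //; exists v; rewrite pE addrAC subrr add0r.
pose q := x ^+ (j - T) * p0.
have xX i : x ^+ i \is i.-homog.
  by have := @dhomogMn _ _ mdeg 1 x i; rewrite mul1n; apply; rewrite dhomogX /= mdeg1.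
have qj : q \is j.-homog by rewrite -(subnK Tj) dhomogM.
have Iq p : graded_part (saturated_jacobian_ideal f) j p ->
    exists c : K, J (p - c *: q).
  case=> /saturated_jacobian_idealE [u [v pE]] hp.
  have /jacobian_idealE [w hw] : jacobian_ideal f (p - pihomog mdeg j (u * p0)).
    by apply: homogJ => //; exists v; rewrite pE addrAC subrr add0r.
  move: hw; rewrite -{1}(subnK Tj) (pihomogM _ _ p0_homog).
  have [c0 [t [s ->]]] := mod_al_z_homog (pihomogP mdeg (j - T) u) => hw.
  exists c0; rewrite /q scalerAl.
  move: hw; rewrite -/x -/y -/z -/al; set X := c0 *: _ => hw.
  have -> : p - X * p0 = z * t * p0 + al * s * p0 + der w f by rewrite -hw; ring.
  by apply: JD; [apply: JD; [apply: Jzp0|apply: Jalp0]|exists w].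
have [Jq|Jq] := classic (J q).
  exists 0%N => //; exists (fun=> 0); split=> [[]//|c' _ []//|p hp].
  exists (fun=> 0); rewrite big_ord0 subr0; split; last by case: hp.
  have [c' hc'] := Iq p hp; apply/jacobian_idealE; rewrite -/(J _).
  by rewrite -(subrK (c' *: q) p); apply: JD => //; rewrite -mul_mpolyC; apply: JM.
exists 1%N => //; exists (fun=> q); split=> [_|c'|p hp].
- split=> //; apply/saturated_jacobian_idealE; exists (x ^+ (j - T)), 0.
  by rewrite der0 addr0.
- rewrite big_ord1 => -[/jacobian_idealE hc _] i; rewrite (ord1 i).
  apply/eqP/negP => /negP c0; apply: Jq.
  have -> : q = ((c' 0)^-1)%:MP * (c' 0 *: q) by rewrite mul_mpolyC scalerA mulVf ?scale1r.
  by apply: JM; exact: hc.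
- have [c' hc'] := Iq p hp; exists (fun=> c'); rewrite big_ord1.
  split; first by apply/jacobian_idealE.
  by case: hp => _ hp; rewrite rpredB // dhomogZ.
Qed.

Lemma arrangement_nearly_free : nearly_free d f.
Proof.
split; first split => //.
- by move=> h j [q hq]; apply: (arrangement_reduced (k := j) f_lines); exists q.
- exists p0; split; last by move/jacobian_idealE; exact: p0_notin_jacobian.
  by apply/saturated_jacobian_idealE; exists 1, 0; rewrite der0 mul1r addr0.
- exact: saturation_quotient_dim.
Qed.

Lemma homog_intP (i : int) (m : nat) (p : S) :
  i = m%:Z -> p \is m.-homog -> homog_int i p.
Proof. by move=> ->. Qed.

Variables m1 m2 : nat.
Hypotheses (d_gt1 : (1 < d)%N) (m1_gt0 : (0 < m1)%N) (m2_gt0 : (0 < m2)%N).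
Hypothesis m12 : (m2 + 1 = m1 + k)%N.
Hypotheses (r1_homog : forall i, r1 0 i \is m1.-homog)
           (r2_homog : forall i, r2 0 i \is m2.-homog)
           (r3_homog : forall i, r3 0 i \is m2.-homog).

(** [m12] says that x^k r1 + z r2 = al r3 is homogeneous; minimality holds as all
    the entries of the three matrices have positive degree. *)
Lemma resolution : minimal_graded_free_resolution (jacobian_ideal f)
  (nseq 3 (d%:Z - 1))
  [:: m1%:Z + (d%:Z - 1); m2%:Z + (d%:Z - 1); m2%:Z + (d%:Z - 1)]
  [:: m2%:Z + 1 + (d%:Z - 1)].
Proof.
pose A1 : 'M[S]_(3, 1) := \matrix_(i, j) f^`M(i).
pose A2 : 'M[S]_(3, 3) := \matrix_(i, j) (tnth [tuple r1; r2; r3] i) 0 j.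
pose A3 : 'M[S]_(1, 3) := \matrix_(i, j) [:: g; z; - al]`_j.
have vA1 (v : 'rV[S]_3) : v *m A1 = (der v f)%:M.
  apply/rowP => j; rewrite !mxE ord1 eqxx mulr1n.
  by apply: eq_bigr => i _; rewrite !mxE.
have vA2 (v : 'rV[S]_3) : v *m A2 = v 0 0 *: r1 + v 0 1 *: r2 + v 0 2 *: r3.
  by apply/rowP => j; rewrite !mxE sum3E !mxE !(tnth_nth 0).
have vA3 (v : 'rV[S]_1) : v *m A3 = \row_j (v 0 0 * [:: g; z; - al]`_j).
  by apply/rowP => j; rewrite !mxE big_ord1 !mxE.
have scalar_inj (p q : S) : (p%:M = q%:M :> 'rV[S]_1) -> p = q.
  by move/rowP/(_ 0); rewrite !mxE eqxx !mulr1n.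
have xh (i : 'I_3) : ('X_i : S) \is 1.-homog by rewrite dhomogX /= mdeg1.
have gh : g \is k.-homog by have := dhomogMn k (xh 0); rewrite mul1n.
have alh : - al \is 1.-homog by rewrite rpredN rpredB ?xh.
have irr m (p : S) : (0 < m)%N -> p \is m.-homog -> irrelevant_ideal p.
  by case: m => // m _; apply: irrelevant_homog.
have dZ : d%:Z - 1 = d.-1%:Z by rewrite -subn1 -subzn // ltnW.
have r1f := r1G r1E af bf; have r2f := r2G r2E bf cf; have r3f := r3G r3E af cf.
exists A1, A2, A3; split.
- split.
  + move=> i j; rewrite (ord1 j) mxE nth_nseq ltn_ord subr0.
    by apply: (@homog_intP _ d.-1); [|exact: mderiv_homog].
  + apply: ord3P => j; rewrite mxE (tnth_nth 0) nth_nseq ltn_ord addrK;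
      exact: homog_intP.
  + move=> i; rewrite (ord1 i); apply: ord3P; rewrite mxE /=.
    * apply: (@homog_intP _ k) => //; rewrite opprD addrACA subrr addr0.
      by rewrite -PoszD m12 PoszD addrAC subrr add0r.
    * by apply: (@homog_intP _ 1) (xh 2); rewrite opprD addrACA subrr addr0 addrAC subrr.
    * by apply: (@homog_intP _ 1) alh; rewrite opprD addrACA subrr addr0 addrAC subrr.
- split.
  + move=> i j; rewrite mxE; apply: (irr d.-1); first by rewrite -ltnS prednK.
    exact: mderiv_homog.
  + by apply: ord3P => j; rewrite mxE (tnth_nth 0); [apply: (irr m1)|apply: (irr m2)|apply: (irr m2)].
  + move=> i; apply: ord3P; rewrite mxE /=.
    * exact: irr k_gt0 gh.
    * exact: irr (ltn0Sn 0) (xh 2).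
    * exact: irr (ltn0Sn 0) alh.
- move=> p; rewrite jacobian_idealE; split=> [[v ->]|[v]].
    by exists v; rewrite [RHS]vA1.
  by rewrite [RHS]vA1 => /scalar_inj ->; exists v.
split.
- move=> v; rewrite [LHS]vA1; split=> [h|[u ->]].
    have /jacobian_syzygy[t1 [t2 [t3 vE]]] : der v f = 0.
      by apply: scalar_inj; rewrite h; apply/rowP => i; rewrite !mxE mul0rn.
    exists (\row_j [:: t1; t2; t3]`_j); rewrite [RHS]vA2 vE !mxE //.
  rewrite [u *m _]vA2 !derD !derZ -![der _ f]/(dot _ _) r1f r2f r3f !mulr0 !addr0.
  by apply/rowP => i; rewrite !mxE mul0rn.
- move=> v; rewrite [v *m _]vA2; split=> [/jacobian_second_syzygy[w [h1 h2 h3]]|[u ->]].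
    exists (w%:M); rewrite [RHS]vA3; apply: rV3P; rewrite !mxE ?h1 ?h2 ?h3 eqxx mulr1n //=.
    by rewrite mulrN.
  rewrite [u *m _]vA3 !mxE /= mulrN scaleNr -!scalerA (rel_r r1E r2E r3E).
  by rewrite scalerDr subrr.
- move=> v; rewrite [v *m _]vA3 => /rowP/(_ 1); rewrite !mxE /= => /eqP.
  rewrite mulf_eq0 (negPf (var_neq0 _ 2)) orbF => /eqP v0.
  by apply/rowP => i; rewrite (ord1 i) v0 mxE.
Qed.
End HilbertBurch.

(** * The three derivations of the arrangement *)

(** The polynomial identities behind the construction hold over any commutative
    ring.  The letters stand for P = x^(n-2), Z = z^(n-1), Y = y^(n-1),
    N = n, N1 = n - 1, s = (x^(n-1) - y^(n-1)) / (x - y), t its derivative in x,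
    sg = (x^n - y^n) / (x - y) and (fx, fy, fz) for the gradient of f; then s, Y
    and sg are polynomials in x, y, P, t, and every identity can be checked by
    expansion. *)
Section Identities.
Variable S : comNzRingType.
Variables x y z P Z t N1 N d s Y sg A B f fx fy fz p0 : S.
Hypotheses (NE : N = N1 + 1) (dE : d = N + N + N1).
Hypotheses (sE : s = N1 * P - (x - y) * t) (YE : Y = x * P - (x - y) * s).
Hypotheses (sgE : sg = x * P + y * s).
Hypotheses (AE : A = y * Y - z * Z) (BE : B = z * Z - x * (x * P)).
Hypothesis fE : f = sg * A * B.
Hypothesis fxE : fx = A * B * (N1 * P + y * t) - N * sg * A * (x * P).
Hypothesis fyE : fy = A * B * (N1 * s - x * t) + N * sg * B * Y.
Hypothesis fzE : fz = N * Z * sg * (x * (x * P) + y * Y - z * Z - z * Z).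
Hypothesis p0E : p0 = d * (N * (Z * (sg * sg) * (x * (x * P) - z * Z))).

Definition row3 (p q r : S) : 'rV[S]_3 := \row_i [:: p; q; r]`_i.

Let E := row3 x y z.
(** In each vector the part not proportional to E takes on f the required
    multiple of p0 modulo f; as E(f) = d f, the multiple of E removes the
    difference. *)
Definition vecA := (y * (N1 * s - x * t) + N * sg) *: E - row3 0 (d * (y * sg)) 0.
Definition vecB := ((N + N) * Z) *: E + row3 0 0 (d * (x * (x * P) - z * Z)).
Definition vecC := row3 (d * (Z * s)) (- (d * (P * Z))) (d * (x * P * s)) - (Z * t) *: E.

Let D (v : 'rV[S]_3) := v 0 0 * fx + v 0 1 * fy + v 0 2 * fz.

Ltac expand := rewrite ?p0E ?fxE ?fyE ?fzE ?fE ?BE ?AE ?sgE ?YE ?sE ?dE ?NE.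

Lemma vecA_f : D vecA = z * p0.
Proof. rewrite /D !mxE /=; expand; ring. Qed.

Lemma vecB_f : D vecB = (x - y) * p0.
Proof. rewrite /D !mxE /=; expand; ring. Qed.

Lemma vecC_f : D vecC = P * p0.
Proof. rewrite /D !mxE /=; expand; ring. Qed.

Lemma vec_det3 :
  det3 ((x - y) *: vecA - z *: vecB) (P *: vecB - (x - y) *: vecC) E
  = d * d * ((x - y) * f).
Proof. rewrite /det3 !mxE /=; expand; ring. Qed.
End Identities.

Section FermatMinusLine.
Variables (K : numFieldType) (k : nat).
Local Notation S := {mpoly K[3]}.
Local Notation x := ('X_(0 : 'I_3) : S).
Local Notation y := ('X_(1 : 'I_3) : S).
Local Notation z := ('X_(2 : 'I_3) : S).

Lemma mderivXn (p : S) m i : (p ^+ m.+1)^`M(i) = m.+1%:R * p ^+ m * p^`M(i).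
Proof.
elim: m => [|m ih]; first by rewrite expr1 expr0 !mul1r.
rewrite exprS mderivM ih (exprS p m) -[m.+2%:R]natr1; ring.
Qed.

Lemma mderivU i j : ('X_j : S)^`M(i) = (i == j)%:R.
Proof.
rewrite mderivX mnm1E eq_sym; case: eqP => [<-|_]; last by rewrite scale0r.
have -> : (U_(i) - U_(i) = 0 :> 'X_{1..3})%MM.
  by apply/mnmP => l; rewrite mnmBE subnn mnm0E.
by rewrite mpolyX0 scale1r.
Qed.

(** The complete homogeneous sum (x^m - y^m) / (x - y). *)
Definition complete_sum m : S := \sum_(i < m) x ^+ (m.-1 - i) * y ^+ i.

Lemma complete_sumE m : (x - y) * complete_sum m = x ^+ m - y ^+ m.
Proof. by rewrite subrXX. Qed.

Lemma complete_sumS m : complete_sum m.+2 = x ^+ m.+1 + y * complete_sum m.+1.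
Proof.
rewrite {1}/complete_sum big_ord_recl /= subn0 expr0 mulr1 mulr_sumr; congr (_ + _).
by apply: eq_bigr => i _; rewrite /bump /= add1n exprS subSS; ring.
Qed.

Lemma complete_sum_homog m : complete_sum m.+1 \is m.-homog.
Proof.
apply: rpred_sum => i _; have xh (j : 'I_3) : ('X_j : S) \is 1.-homog by rewrite dhomogX /= mdeg1.
have := dhomogM (dhomogMn (m - i) (xh 0)) (dhomogMn i (xh 1)).
by rewrite !mul1n subnK // -ltnS.
Qed.

Local Notation n := k.+2.
Local Notation s := (complete_sum k.+1).
Local Notation sg := (complete_sum k.+2).
Local Notation t := (s^`M(0)).
Local Notation P := (x ^+ k).
Local Notation Z := (z ^+ k.+1).
Local Notation Y := (y ^+ k.+1).
Local Notation N := (k.+2%:R : S).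
Local Notation N1 := (k.+1%:R : S).
Local Notation d := ((3 * n - 1)%:R : S).
Local Notation A := (y * Y - z * Z).
Local Notation B := (z * Z - x * (x * P)).
Local Notation f := (NF_poly K n).

(** The generator p0 of the saturation modulo the Jacobian ideal. *)
Definition saturating_form : S :=
  d * (N * (Z * (sg * sg) * (x * (x * P) - z * Z))).
Local Notation p0 := saturating_form.

Let NE : N = N1 + 1. Proof. by rewrite natr1. Qed.
Let dE : d = N + N + N1. Proof. by rewrite -!natrD; congr (_ %:R); lia. Qed.

Let al0 : x - y != 0. Proof. exact: al_neq0. Qed.

Let sE : s = N1 * P - (x - y) * t.
Proof.
have := congr1 (mderiv 0) (complete_sumE k.+1).
rewrite mderivM !mderivB !mderivXn !mderivU /= subr0 mulr1 mulr0 mul1r subr0.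
by move=> <-; rewrite addrK.
Qed.

Let YE : Y = x * P - (x - y) * s.
Proof. by rewrite complete_sumE -exprS subKr. Qed.

Let sgE : sg = x * P + y * s.
Proof. by rewrite complete_sumS exprS. Qed.

Let fE : f = sg * A * B.
Proof. by rewrite -!exprS. Qed.

Let dsg i : (x - y) * sg^`M(i) = ((x ^+ n - y ^+ n)^`M(i) - ((i == 0)%:R - (i == 1)%:R) * sg).
Proof. rewrite -complete_sumE mderivM mderivB !mderivU; ring. Qed.

Let df i : f^`M(i) = sg^`M(i) * A * B
  + sg * (N * Y * (i == 1)%:R - N * Z * (i == 2)%:R) * B
  + sg * A * (N * Z * (i == 2)%:R - N * (x * P) * (i == 0)%:R).
Proof.
have dA : A^`M(i) = N * Y * (i == 1)%:R - N * Z * (i == 2)%:R.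
  by rewrite -!exprS mderivB !mderivXn !mderivU.
have dB : B^`M(i) = N * Z * (i == 2)%:R - N * (x * P) * (i == 0)%:R.
  by rewrite -!exprS mderivB !mderivXn !mderivU.
by rewrite fE 2!mderivM mulrDl dA dB.
Qed.

Let fxE : f^`M(0) = A * B * (N1 * P + y * t) - N * sg * A * (x * P).
Proof.
rewrite df /=.
have -> : sg^`M(0) = N1 * P + y * t.
  rewrite complete_sumS mderivD mderivXn mderivM !mderivU /=; ring.
ring.
Qed.

Let fyE : f^`M(1) = A * B * (N1 * s - x * t) + N * sg * B * Y.
Proof.
rewrite df /=.
have -> : sg^`M(1) = N1 * s - x * t.
  apply: (mulfI al0); rewrite dsg mderivB !mderivXn !mderivU /= YE sgE.
  by rewrite [X in _ = (x - y) * (_ * X - _)]sE [in LHS]sE NE; ring.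
ring.
Qed.

Let fzE : f^`M(2) = N * Z * sg * (x * (x * P) + y * Y - z * Z - z * Z).
Proof.
rewrite df /=.
have -> : sg^`M(2) = 0.
  by apply: (mulfI al0); rewrite dsg mderivB !mderivXn !mderivU /=; ring.
ring.
Qed.

Definition derA := vecA x y z t N1 N d s sg.
Definition derB := vecB x y z P Z N d.
Definition derC := vecC x y z P Z t d s.

Let eulerE : euler K = row3 x y z.
Proof. by apply: rV3P; rewrite !mxE. Qed.

Lemma derA_f : der derA f = z * p0.
Proof. by rewrite derE; apply: (vecA_f NE dE sE YE sgE erefl erefl fxE fyE fzE erefl). Qed.
Lemma derB_f : der derB f = (x - y) * p0.
Proof. by rewrite derE; apply: (vecB_f NE dE sE YE sgE erefl erefl fxE fyE fzE erefl). Qed.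
Lemma derC_f : der derC f = P * p0.
Proof. by rewrite derE; apply: (vecC_f NE dE sE YE sgE erefl erefl fxE fyE fzE erefl). Qed.
Lemma derABC_det3 :
  det3 ((x - y) *: derA - z *: derB) (P *: derB - (x - y) *: derC) (euler K)
  = ((3 * n - 1)%:R ^+ 2)%:MP * ((x - y) * f).
Proof.
rewrite eulerE (vec_det3 NE dE sE YE sgE erefl erefl fE).
by rewrite rmorphXn /= mpolyC_nat.
Qed.
End FermatMinusLine.

(** * Degrees and conclusions for the arrangement *)

Section Assembly.
Variables (K : numFieldType) (k : nat).
Local Notation S := {mpoly K[3]}.
Local Notation x := ('X_(0 : 'I_3) : S).
Local Notation y := ('X_(1 : 'I_3) : S).
Local Notation z := ('X_(2 : 'I_3) : S).
Local Notation n := k.+2.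
Local Notation f := (NF_poly K n).
Hypothesis k_gt0 : (0 < k)%N.

Lemma homogM (i j m : nat) (p q : S) :
  p \is i.-homog -> q \is j.-homog -> (i + j)%N = m -> p * q \is m.-homog.
Proof. by move=> hp hq <-; apply: dhomogM. Qed.

Lemma homog_natM c m (p : S) : p \is m.-homog -> c%:R * p \is m.-homog.
Proof. by move=> hp; rewrite mulr_natl rpredMn. Qed.

Let Xh (i : 'I_3) : ('X_i : S) \is 1.-homog.
Proof. by rewrite dhomogX /= mdeg1. Qed.

Let Xnh (i : 'I_3) m : ('X_i : S) ^+ m \is m.-homog.
Proof. by have := dhomogMn m (Xh i); rewrite mul1n. Qed.

Let sh := complete_sum_homog K k.
Let sgh := complete_sum_homog K k.+1.
Let th := mderiv_homog 0 sh.
Let alh : x - y \is 1.-homog. Proof. by apply: rpredB; apply: Xh. Qed.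

Let xxP : x * (x * x ^+ k) - z * z ^+ k.+1 \is n.-homog.
Proof. by rewrite -!exprS; apply: rpredB; apply: Xnh. Qed.

Definition row_homog m (v : 'rV[S]_3) := forall i, v 0 i \is m.-homog.

Let row_homogB m u v : row_homog m u -> row_homog m v -> row_homog m (u - v).
Proof. by move=> hu hv i; rewrite !mxE rpredB ?hu ?hv. Qed.

Let row_homogD m u v : row_homog m u -> row_homog m v -> row_homog m (u + v).
Proof. by move=> hu hv i; rewrite !mxE rpredD ?hu ?hv. Qed.

Let row_homogZ i j m (p : S) v : p \is i.-homog -> row_homog j v ->
  (i + j)%N = m -> row_homog m (p *: v).
Proof. by move=> hp hv ij l; rewrite mxE; apply: homogM ij. Qed.

Let row3_homog m (p q r : S) : p \is m.-homog -> q \is m.-homog ->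
  r \is m.-homog -> row_homog m (row3 p q r).
Proof. by move=> hp hq hr; apply: ord3P; rewrite mxE. Qed.

Let euler_homog : row_homog 1 (row3 x y z).
Proof. by apply: row3_homog; apply: Xh. Qed.

Let derA_homog : row_homog n (derA K k).
Proof.
apply: row_homogB.
  apply: row_homogZ euler_homog (addn1 _); apply: rpredD; last exact: homog_natM.
  apply: homogM (Xh 1) _ (add1n _); apply: rpredB; first exact: homog_natM.
  by apply: homogM (Xh 0) th _; lia.
apply: row3_homog; rewrite ?rpred0 //; apply: homog_natM.
by apply: homogM (Xh 1) sgh _; lia.
Qed.

Let derB_homog : row_homog n (derB K k).
Proof.
apply: row_homogD.
  apply: row_homogZ euler_homog (addn1 _); rewrite mulrDl.
  by apply: rpredD; apply: homog_natM; apply: Xnh.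
by apply: row3_homog; rewrite ?rpred0 //; apply: homog_natM.
Qed.

Let derC_homog : row_homog (k + k.+1) (derC K k).
Proof.
apply: row_homogB; last first.
  by apply: row_homogZ (homogM (Xnh 2 k.+1) th erefl) euler_homog _; lia.
apply: row3_homog; rewrite ?rpredN -?mulrA; apply: homog_natM.
- by apply: homogM (Xnh 2 k.+1) sh _; lia.
- exact: dhomogM (Xnh 0 k) (Xnh 2 k.+1).
- by rewrite mulrA -exprS; apply: homogM (Xnh 0 k.+1) sh _; lia.
Qed.

Local Notation r1 := ((x - y) *: derA K k - z *: derB K k).
Local Notation r2 := (x ^+ k *: derB K k - (x - y) *: derC K k).
Local Notation r3 := (x ^+ k *: derA K k - z *: derC K k).

Let r1_homog : row_homog (n + 1) r1.
Proof.
apply: row_homogB; first by apply: row_homogZ alh derA_homog _; lia.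
by apply: row_homogZ (Xh 2) derB_homog _; lia.
Qed.

Let r2_homog : row_homog (2 * n - 2) r2.
Proof.
apply: row_homogB; first by apply: row_homogZ (Xnh 0 k) derB_homog _; lia.
by apply: row_homogZ alh derC_homog _; lia.
Qed.

Let r3_homog : row_homog (2 * n - 2) r3.
Proof.
apply: row_homogB; first by apply: row_homogZ (Xnh 0 k) derA_homog _; lia.
by apply: row_homogZ (Xh 2) derC_homog _; lia.
Qed.

Let p0_homog : saturating_form K k \is (4 * n - 3).-homog.
Proof.
rewrite /saturating_form; do 2 apply: homog_natM.
apply: homogM (homogM (Xnh 2 k.+1) (homogM sgh sgh erefl) erefl) xxP _; lia.
Qed.

(** The point (0 : 2 : 1) is off the curve since 2^n differs from 1. *)
Lemma NF_poly_point m : (0 < m)%N -> NF_poly K m \mPo subst3 0 (z + z) z != 0.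
Proof.
move=> m_gt0; pose u := subst3 0 (z + z) z.
have comp_exp (p : S) j : (p ^+ j) \mPo u = (p \mPo u) ^+ j.
  by elim: j => [|j ih]; rewrite ?comp_mpoly1 // !exprS comp_mpolyM ih.
have nz j : z ^+ m *+ j.+1 != 0.
  by rewrite -mulr_natl mulf_neq0 ?expf_neq0 ?var_neq0 // -mpolyC_nat mpolyC_eq0 pnatr_eq0.
have zzE : (z + z) ^+ m = z ^+ m *+ 2 ^ m.
  by move: z m {m_gt0 nz} => w m; rewrite -mulr2n exprMn_n.
move: (NF_poly K m) (NF_polyE K m) => F /(congr1 (comp_mpoly u)).
rewrite 3!comp_mpolyM 4!comp_mpolyB !comp_exp comp_X0 comp_X1 comp_X2 /=.
rewrite expr0n (gtn_eqF m_gt0) mulr0n !sub0r subr0 => h.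
have m2 : (1 < 2 ^ m)%N by rewrite -{1}(expn0 2) ltn_exp2l.
have : - (z + z) ^+ m * ((z + z) ^+ m - z ^+ m) * z ^+ m != 0.
  rewrite zzE; case: (2 ^ m)%N m2 => [|[|q]] // _.
  by rewrite {2}mulrSr addrK !mulf_neq0 ?oppr_eq0 ?nz // expf_neq0 // var_neq0.
by apply: contra_neq => F0; rewrite -h F0 mulr0.
Qed.

Let e0 : (3 * n - 1)%:R ^+ 2 != 0 :> K.
Proof. by rewrite expf_neq0 // pnatr_eq0; lia. Qed.

Hypothesis f_lines : line_arrangement (3 * n - 1) f.

Lemma NF_nearly_free : nearly_free (3 * n - 1) f.
Proof.
apply: (arrangement_nearly_free _ k_gt0 e0 f_lines erefl erefl erefl
  (derA_f _ _) (derB_f _ _) (derC_f _ _) (derABC_det3 _ _) (NF_poly_point (ltn0Sn _)) p0_homog); lia.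
Qed.

Lemma NF_exponents :
  nearly_free_exponents (3 * n - 1) f (n%:Z + 1) (2 * n%:Z - 2).
Proof.
exists (2 * n%:Z - 2), (2 * n%:Z - 2 - (3 * n - 1)%:Z + 2); split=> //; try lia.
have res := @resolution K (3 * n - 1) k f (saturating_form K k) _ _ _ r1 r2 r3 _
  _ k_gt0 e0 f_lines erefl erefl erefl (derA_f K k) (derB_f K k) (derC_f K k)
  (derABC_det3 K k) (n + 1) (2 * n - 2) _ _ _ _ r1_homog r2_homog r3_homog.
have -> : n%:Z + 1 = (n + 1)%:Z by lia.
have -> : 2 * n%:Z - 2 = (2 * n - 2)%:Z by lia.
rewrite (_ : _ + 2 * _ = (2 * n - 2)%:Z + 1 + ((3 * n - 1)%:Z - 1)); last by lia.
by apply: res; lia.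
Qed.
End Assembly.

(** * Roots of unity and the lines *)

Section Homogenization.
Variables (K : fieldType) (S : comAlgType K) (p q : S).

Definition homogenize m (P : {poly K}) : S :=
  \sum_(i < m.+1) P`_i *: (p ^+ i * q ^+ (m - i)).

Lemma homogenizeM m (P : {poly K}) r : (size P <= m.+1)%N ->
  homogenize m.+1 (('X - r%:P) * P) = (p - r *: q) * homogenize m P.
Proof.
move=> sP; rewrite /homogenize [RHS]mulrBl !mulr_sumr.
under eq_bigr do rewrite mulrBl coefB coefXM coefCM scalerBl.
rewrite sumrB; congr (_ - _).
  rewrite big_ord_recl /= scale0r add0r; apply: eq_bigr => i _.
  by rewrite -scalerAr mulrA -exprS.
rewrite big_ord_recr /= nth_default // mulr0 scale0r addr0.
apply: eq_bigr => i _; rewrite -scalerA subSn -1?ltnS // exprS.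
by rewrite -scalerAl -scalerAr mulrCA.
Qed.

Lemma homogenize_prod (rs : seq K) :
  \prod_(r <- rs) (p - r *: q) = homogenize (size rs) (\prod_(r <- rs) ('X - r%:P)).
Proof.
elim: rs => [|r rs ih] /=.
  by rewrite !big_nil /homogenize big_ord1 coef1 subnn !expr0 mulr1 scale1r.
by rewrite !big_cons ih -homogenizeM // size_prod_XsubC.
Qed.

(** The factorisation of X^n - 1, homogenised and evaluated at (p, q). *)
Lemma prod_unity_roots (rs : seq K) n : (0 < n)%N ->
  \prod_(r <- rs) ('X - r%:P) = 'X^n - 1 ->
  \prod_(r <- rs) (p - r *: q) = p ^+ n - q ^+ n.
Proof.
case: n => // n _ h; have sz : size rs = n.+1.
  by apply: succn_inj; rewrite -(size_prod_XsubC rs id) h size_XnsubC.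
rewrite homogenize_prod sz h /homogenize.
under eq_bigr do rewrite coefB coefXn coef1 scalerBl.
rewrite sumrB; congr (_ - _).
  rewrite big_ord_recr /= eqxx scale1r subnn mulr1 big1 ?add0r // => i _.
  by rewrite (ltn_eqF (ltn_ord i)) scale0r.
rewrite big_ord_recl /= scale1r subn0 expr0 mul1r big1 ?addr0 // => i _.
by rewrite scale0r.
Qed.
End Homogenization.

Lemma unity_roots (C : numClosedFieldType) n : (0 < n)%N ->
  exists rs : seq C, [/\ uniq (1 :: rs), all (fun r => r != 0) rs, size rs = n.-1 &
    \prod_(r <- 1 :: rs) ('X - r%:P) = 'X^n - 1].
Proof.
move=> n_gt0; have [r] := closed_field_poly_normal ('X^n - 1 : {poly C}).
rewrite (monicP _) ?monicXnsubC // scale1r => rE.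
have r_uniq : uniq r.
  rewrite -separable.separable_prod_XsubC -rE cyclotomic.separable_Xn_sub_1 //.
  by rewrite pnatr_eq0 -lt0n.
have rP z : z \in r -> z ^+ n = 1.
  by rewrite -root_prod_XsubC -rE => /eqP; rewrite !hornerE => /eqP; rewrite subr_eq0 => /eqP.
have r1 : 1 \in r by rewrite -root_prod_XsubC -rE rootE !hornerE expr1n subrr.
have pr := perm_to_rem r1.
exists (rem 1 r); split.
- by rewrite -(perm_uniq pr).
- apply/allP => z /mem_rem /rP zn; apply: contra_eq_neq zn => ->.
  by rewrite expr0n (gtn_eqF n_gt0) eq_sym oner_eq0.
- by rewrite size_rem // -[size r]/((size r).+1.-1) -(size_prod_XsubC r id) -rE size_XnsubC.
- by rewrite -(perm_big _ pr) -rE.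
Qed.

Section Lines.
Variables (C : numClosedFieldType).
Local Notation S := {mpoly C[3]}.

(** The index is cyclic, so this covers x - r y, y - r z and z - r x. *)
Definition cyclic_line (tr : 'I_3 * C) : S := 'X_(tr.1) - tr.2 *: 'X_(tr.1 + 1).

Lemma cyclic_line_coef tr (j : 'I_3) :
  (cyclic_line tr)@_U_(j) = (tr.1 == j)%:R - tr.2 * (tr.1 + 1 == j)%:R.
Proof. by rewrite mcoeffB mcoeffZ !mcoeffXU. Qed.

Lemma ord3_succ_neq (i : 'I_3) : (i + 1 == i) = false.
Proof. by move: i; apply: ord3P. Qed.

(** Comparing supports in the three variables first forces the same index, then
    the coefficient 1 forces the same root. *)
Lemma cyclic_line_inj tr tr' (c : C) : tr.2 != 0 -> tr'.2 != 0 ->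
  cyclic_line tr = c *: cyclic_line tr' -> tr = tr'.
Proof.
case: tr tr' => [i r] [j s] /= r0 s0 h.
have h' l : (i == l)%:R - r * (i + 1 == l)%:R = c * ((j == l)%:R - s * (j + 1 == l)%:R).
  by have := congr1 (mcoeff U_(l)) h; rewrite mcoeffZ !cyclic_line_coef.
have c0 : c != 0.
  apply: contra_eq_neq (h' i) => ->; rewrite mul0r eqxx.
  by rewrite ord3_succ_neq mulr0 subr0 oner_eq0.
have contra u : u != 0 -> 0 = c * u -> False.
  by move=> u0 /esym/eqP; rewrite mulf_eq0 (negPf c0) (negPf u0).
have s1 : - s != 0 by rewrite oppr_eq0.
have eq_rs : 1 = c -> - r = c * - s -> r = s by move=> <-; rewrite mul1r => /oppr_inj.
move: (h' 0) (h' 1) (h' 2) => {h h'}.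
move: i; apply: ord3P; move: j; apply: ord3P => /=;
  rewrite ?(mulr0, mulr1) ?(subr0, sub0r) ?(oppr0, mulr1) ?mulr0 => e0 e1 e2;
  first [by rewrite (eq_rs e0 e1) | by rewrite (eq_rs e1 e2) | by rewrite (eq_rs e2 e0)
   | by case: (contra _ s1 e0) | by case: (contra _ s1 e1) | by case: (contra _ s1 e2)
   | by case/eqP: c0].
Qed.

Lemma cyclic_line_homog tr : cyclic_line tr \is 1.-homog.
Proof. by rewrite rpredB ?rpredZ // dhomogX /= mdeg1. Qed.

Lemma cyclic_line_neq0 tr : cyclic_line tr != 0.
Proof.
apply/eqP => /(congr1 (mcoeff U_(tr.1))) /eqP.
rewrite cyclic_line_coef mcoeff0 eqxx.
by rewrite ord3_succ_neq mulr0 subr0 oner_eq0.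
Qed.

Lemma cyclic_lines_arrangement (L : seq ('I_3 * C)) :
  uniq L -> all (fun tr => tr.2 != 0) L ->
  line_arrangement (size L) (\prod_(tr <- L) cyclic_line tr).
Proof.
move=> uL L0; exists (fun i => cyclic_line (tnth (in_tuple L) i)); split.
- by move=> i; apply: cyclic_line_homog.
- by move=> i; apply: cyclic_line_neq0.
- move=> i j ij [c]; have L0' l : (tnth (in_tuple L) l).2 != 0.
    by apply: (allP L0); apply: mem_tnth.
  move/cyclic_line_inj => /(_ (L0' i) (L0' j)) h.
  case/eqP: ij; apply: val_inj; apply/eqP.
  rewrite -(nth_uniq (0, 0) (ltn_ord i) (ltn_ord j) uL).
  by rewrite -!(tnth_nth (0, 0) (in_tuple L)) h.
- by rewrite big_tnth.
Qed.

Lemma NF_line_arrangement n : (0 < n)%N ->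
  line_arrangement (3 * n - 1) (NF_poly C n).
Proof.
move=> n_gt0; have [rs [urs rs0 sz hrs]] := unity_roots C n_gt0.
pose lines (i : 'I_3) s := [seq (i, r) | r <- s] : seq ('I_3 * C).
pose L := lines 0 rs ++ lines 1 (1 :: rs) ++ lines 2 (1 :: rs).
have prodE (i : 'I_3) : \prod_(tr <- lines i (1 :: rs)) cyclic_line tr
    = 'X_i ^+ n - 'X_(i + 1) ^+ n.
  by rewrite big_map -(prod_unity_roots _ _ n_gt0 hrs).
have x0 : varx C - vary C != 0 by exact: al_neq0.
have <- : \prod_(tr <- L) cyclic_line tr = NF_poly C n.
  apply: (mulfI x0); rewrite NF_polyE !big_cat /= !prodE -[RHS]mulrA [LHS]mulrA.
  have [-> ->] : (1 + 1 = 2 :> 'I_3) /\ (2 + 1 = 0 :> 'I_3) by split; apply: val_inj.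
  congr (_ * _); have := prodE 0.
  by rewrite /= big_cons add0r /cyclic_line /= scale1r add0r.
have -> : (3 * n - 1)%N = size L by rewrite !size_cat !size_map /= sz; lia.
have inj (i : 'I_3) : injective (fun r : C => (i, r)) by move=> r r' [].
have disj (i j : 'I_3) s s' : i != j -> ~~ has (mem (lines i s)) (lines j s').
  move=> ij; apply/hasPn => tr /mapP[r _ ->]; apply/mapP => -[r' _ [ji _]].
  by rewrite ji eqxx in ij.
apply: cyclic_lines_arrangement.
  rewrite !cat_uniq !map_inj_uniq // has_cat negb_or !disj // urs.
  by apply/andP; split=> //; case/andP: urs.
by rewrite !all_cat !all_map /= oner_eq0 !rs0.
Qed.
End Lines.

Theorem proposition2p1 (R : realType) (n : nat) (hn : (3 <= n)%N) :
  let Q : {mpoly R[i][3]} := NF_poly R[i] n in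
  [/\ line_arrangement (3 * n - 1) Q,
      nearly_free (3 * n - 1) Q &
      nearly_free_exponents (3 * n - 1) Q (n%:Z + 1) (2 * n%:Z - 2)].
Proof.
have f_lines : line_arrangement (3 * n - 1) (NF_poly R[i] n).
  by apply: NF_line_arrangement; apply: leq_trans hn.
case: n hn f_lines => [|[|k]] // k_gt0 f_lines; split=> //.
  exact: (NF_nearly_free k_gt0 f_lines).
exact: (NF_exponents k_gt0 f_lines).
Qed.
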